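(* The problems $\mathrm{online}\text{-}\mathrm{plurality}\text{-}\mathrm{CCDV}$, $\mathrm{online}\text{-}\mathrm{plurality}\text{-}\mathrm{CCAV}$, $\mathrm{online}\text{-}\mathrm{plurality}\text{-}\mathrm{DCDV}$, and $\mathrm{online}\text{-}\mathrm{plurality}\text{-}\mathrm{DCAV}$ are in $\mathrm{P}$.
   Context: Elections. An election is a pair $(C,V)$, where $C$ is a finite set of candidates and $V$ is a finite list of votes, each of the form $(v,p)$ with $v$ the voter's name and $p$ a strict total preference order over $C$. In plurality, each voter gives one point to her most preferred candidate, and all candidates with the most points win. $W(C,V)\subseteq C$ denotes the set of plurality winners. Online voter control. Voters vote sequentially in a fixed order. A basic online voter control setting (OVCS) $(C,u,V,\sigma,d)$ consists of a candidate set $C$; the current voter $u$; an election snapshot $V=(V_{<u},u,V_{u<})$, where $V_{<u}$ lists the earlier voters in order, who have already cast votes over $C$, and $V_{u<}$ gives only the names and the order of the future voters (not their votes); the chair's strict total preference order $\sigma$ on $C$; and a distinguished candidate $d\in C$. The question (for each control type below) is: does there exist an allowed action of the chair regarding $u$ such that, no matter what votes (arbitrary preference orders over $C$) the voters after $u$ cast, the chair's goal can be reached by that action together with her future actions? When each later voter's turn comes, that voter's vote is revealed and then the chair must immediately choose her action (if any) regarding that voter, knowing all votes revealed so far but not later votes; so this is an alternation of ''there exists an action'' and ''for all next votes''. With $(C,V')$ denoting the election resulting after all actions and votes, the chair's goal is $W(C,V')\cap\{c \mid c\geq_\sigma d\}\neq\emptyset$ in the constructive case, and $W(C,V')\cap\{c\mid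 d\geq_\sigma c\}=\emptyset$ in the destructive case. Here $c \geq_\sigma d$ means $c=d$ or the chair prefers $c$ to $d$. Deleting voters: the input is a basic OVCS together with a nonnegative integer $k$ (deletion limit); for each voter before $u$, a flag saying whether that voter was deleted (at most $k$ are so flagged), and the vote cast if not deleted; and the vote $u$ will cast if not deleted. The action for $u$ and each later voter is to delete the voter or not, with at most $k$ voters deleted in total (including those already deleted). $V'$ consists of the votes of all nondeleted voters. The problems are $\mathrm{online}\text{-}\mathrm{plurality}\text{-}\mathrm{CCDV}$ (constructive) and $\mathrm{online}\text{-}\mathrm{plurality}\text{-}\mathrm{DCDV}$ (destructive). Adding voters: the input is a basic OVCS together with a nonnegative integer $k$ (addition limit); for each voter in $V$, a flag saying whether the voter is registered or unregistered ($u$ must be unregistered); for each unregistered voter before $u$, a flag saying whether that voter was added (at most $k$ are so flagged); the vote of each registered or added voter before $u$; and the vote $u$ will cast if added. The action for $u$ and each later unregistered voter is to add the voter or not, with at most $k$ voters added in total (including those already added); there is no action for registered voters. $V'$ consists of the votes of all registered and all added voters. The problems are $\mathrm{online}\text{-}\mathrm{plurality}\text{-}\mathrm{CCAV}$ (constructive) and $\mathrm{online}\text{-}\mathrm{plurality}\text{-}\mathrm{DCAV}$ (destructive). *)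

(* Defs.v *)
From HB Require Import structures.
From mathcomp Require Import all_boot.
From Stdlib Require Import BinNums.

Set Implicit Arguments.
Unset Strict Implicit.
Unset Printing Implicit Defensive.

(** * Deterministic multi-tape Turing machines and the class P *)

(* [None] is the blank; the tape alphabet consists of the blank, the input
   alphabet [Sigma] and the work symbols [Work]. *)
Definition cell (Sigma Work : Type) : Type := option (Sigma + Work).

Inductive move := MoveL | MoveS | MoveR.

(* [verdict q] is [Some true] on accepting states, [Some false] on rejecting
   states and [None] on the states in which the machine goes on.  The machine
   has one input tape, number 0, and [nwork] work tapes; all of them can be
   written. *)
Record turing_machine (Sigma : finType) := TuringMachine {
  nwork : nat;
  work : finType;
  state : finType;
  start : state;
  verdict : state -> option bool;
  delta : state -> {ffun 'I_nwork.+1 -> cell Sigma work} ->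
          state * {ffun 'I_nwork.+1 -> cell Sigma work * move}
}.

(* A tape that is infinite in both directions: the cells to the left of the
   head (nearest first), the scanned cell, the cells to the right of the head
   (nearest first).  All cells beyond the two lists are blank. *)
Record tape (S : Type) := Tape {
  lcells : seq (option S);
  scanned : option S;
  rcells : seq (option S)
}.

Definition move_head (S : Type) (m : move) (t : tape S) : tape S :=
  match m with
  | MoveL => Tape (behead (lcells t)) (head None (lcells t))
                  (scanned t :: rcells t)
  | MoveS => t
  | MoveR => Tape (scanned t :: lcells t) (head None (rcells t))
                  (behead (rcells t))
  end.

Definition write (S : Type) (a : option S) (t : tape S) : tape S :=
  Tape (lcells t) a (rcells t).

Definition blank_tape (S : Type) : tape S := Tape [::] None [::].

Definition tape_of_word (S : Type) (w : seq S) : tape S :=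
  Tape [::] (ohead w) (map Some (behead w)).

Section Run.
Variables (Sigma : finType) (M : turing_machine Sigma).

Definition config : Type :=
  (state M * {ffun 'I_(nwork M).+1 -> tape (Sigma + work M)})%type.

Definition init (w : seq Sigma) : config :=
  (start M, [ffun i => if i == ord0 then tape_of_word (map inl w)
                       else blank_tape _]).

Definition step (c : config) : config :=
  if verdict c.1 is Some _ then c else
  let: (q, act) := delta c.1 [ffun i => scanned (c.2 i)] in
  (q, [ffun i => move_head (act i).2 (write (act i).1 (c.2 i))]).

Definition answer_within (t : nat) (w : seq Sigma) : option bool :=
  verdict (iter t step (init w)).1.

End Run.

Definition language (Sigma : Type) : Type := seq Sigma -> Prop.

Definition decides_in_time (Sigma : finType) (M : turing_machine Sigma)
    (f : nat -> nat) (L : language Sigma) : Prop :=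
  forall w, exists2 b : bool,
    answer_within M (f (size w)) w = Some b & (b <-> L w).

Definition in_P (Sigma : finType) (L : language Sigma) : Prop :=
  exists (M : turing_machine Sigma) (a e : nat),
    decides_in_time M (fun n => a * n ^ e + a) L.

(** * Plurality elections *)

Definition candidate := nat.
Definition voter := nat.

(* A strict total order on the candidates is given by its ranking, the most
   preferred candidate first. *)
Definition order := seq candidate.

(* For use with a duplicate-free [C]. *)
Definition is_order (C : seq candidate) (p : order) : bool := perm_eq p C.

Definition prefers (p : order) (c d : candidate) : bool := index c p < index d p.

Definition weakly_prefers (p : order) (c d : candidate) : bool :=
  (c == d) || prefers p c d.

Definition vote : Type := (voter * order)%type.

Definition score (V : seq vote) (c : candidate) : nat :=
  count (fun v : vote => ohead v.2 == Some c) V.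

Definition winners (C : seq candidate) (V : seq vote) : seq candidate :=
  [seq c <- C | all (fun c' => score V c' <= score V c) C].

(** * Online voter control *)

Inductive control := Constructive | Destructive.

Definition chair_goal (g : control) (C : seq candidate) (sigma : order)
    (d : candidate) (V : seq vote) : Prop :=
  match g with
  | Constructive => exists2 c, c \in winners C V & weakly_prefers sigma c d
  | Destructive => ~ exists2 c, c \in winners C V & weakly_prefers sigma d c
  end.

(** ** Deleting voters *)

(* A past voter has no order ([None]) exactly if she was deleted. *)
Record dv_instance := DVInstance {
  dv_candidates : seq candidate;
  dv_past : seq (voter * option order);
  dv_current : vote;
  dv_future : seq voter;
  dv_chair : order;
  dv_dist : candidate;
  dv_limit : nat
}.

Definition dv_deleted (I : dv_instance) : nat :=
  count (fun e : voter * option order => ~~ e.2) (dv_past I).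

Definition dv_kept (I : dv_instance) : seq vote :=
  pmap (fun e : voter * option order => omap (pair e.1) e.2) (dv_past I).

Definition dv_wf (I : dv_instance) : bool :=
  let C := dv_candidates I in
  [&& uniq C, dv_dist I \in C, is_order C (dv_chair I),
      all (fun v : vote => is_order C v.2) (dv_kept I),
      is_order C (dv_current I).2 & dv_deleted I <= dv_limit I].

Section DeletingGame.
Variables (C : seq candidate) (k : nat) (goal : seq vote -> Prop).

(* It is the turn of the voter of [v], whose vote has just been revealed; so
   far [n] voters were deleted and the votes [V] were kept, and the voters in
   [future] are still to come. *)
Fixpoint dv_force (n : nat) (V : seq vote) (v : vote) (future : seq voter)
    : Prop :=
  let continue n' V' :=
    if future is x :: future' then
      forall p, is_order C p -> dv_force n' V' (x, p) future'
    else goal V' in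
  continue n (rcons V v) \/ (n < k /\ continue n.+1 V).

End DeletingGame.

Definition dv_yes (g : control) (I : dv_instance) : Prop :=
  dv_force (dv_candidates I) (dv_limit I)
    (chair_goal g (dv_candidates I) (dv_chair I) (dv_dist I))
    (dv_deleted I) (dv_kept I) (dv_current I) (dv_future I).

(** ** Adding voters *)

Inductive past_status :=
  | Registered of order
  | Added of order
  | NotAdded.

Definition status_order (s : past_status) : option order :=
  match s with Registered p | Added p => Some p | NotAdded => None end.

Definition is_added (s : past_status) : bool :=
  if s is Added _ then true else false.

(* The flag of a future voter tells whether she is registered; the current
   voter is unregistered. *)
Record av_instance := AVInstance {
  av_candidates : seq candidate;
  av_past : seq (voter * past_status);
  av_current : vote;
  av_future : seq (voter * bool);
  av_chair : order;
  av_dist : candidate;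
  av_limit : nat
}.

Definition av_added (I : av_instance) : nat :=
  count (fun e : voter * past_status => is_added e.2) (av_past I).

Definition av_counted (I : av_instance) : seq vote :=
  pmap (fun e : voter * past_status => omap (pair e.1) (status_order e.2))
       (av_past I).

Definition av_wf (I : av_instance) : bool :=
  let C := av_candidates I in
  [&& uniq C, av_dist I \in C, is_order C (av_chair I),
      all (fun v : vote => is_order C v.2) (av_counted I),
      is_order C (av_current I).2 & av_added I <= av_limit I].

Section AddingGame.
Variables (C : seq candidate) (k : nat) (goal : seq vote -> Prop).

(* As [dv_force]: [n] voters were added so far, the votes [V] count, and [reg]
   tells whether the voter of [v] is registered. *)
Fixpoint av_force (n : nat) (V : seq vote) (v : vote) (reg : bool)
    (future : seq (voter * bool)) : Prop :=
  let continue n' V' :=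
    if future is x :: future' then
      forall p, is_order C p -> av_force n' V' (x.1, p) x.2 future'
    else goal V' in
  if reg then continue n (rcons V v)
  else continue n V \/ (n < k /\ continue n.+1 (rcons V v)).

End AddingGame.

Definition av_yes (g : control) (I : av_instance) : Prop :=
  av_force (av_candidates I) (av_limit I)
    (chair_goal g (av_candidates I) (av_chair I) (av_dist I))
    (av_added I) (av_counted I) (av_current I) false (av_future I).

(** * Instances as words *)

Inductive sym := Bit of bool | Sep | Open | Close.

Definition sym_code (s : sym) : bool + option bool :=
  match s with
  | Bit b => inl b
  | Sep => inr None
  | Open => inr (Some true)
  | Close => inr (Some false)
  end.

Definition sym_decode (s : bool + option bool) : sym :=
  match s with
  | inl b => Bit b
  | inr None => Sep
  | inr (Some true) => Open
  | inr (Some false) => Close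
  end.

Lemma sym_codeK : cancel sym_code sym_decode.
Proof. by case. Qed.

HB.instance Definition _ := Finite.copy sym (can_type sym_codeK).

Fixpoint pos_bits (p : positive) : seq bool :=
  match p with
  | xH => [:: true]
  | xO p' => false :: pos_bits p'
  | xI p' => true :: pos_bits p'
  end.

(* Binary digits, the least significant one first; none for 0. *)
Definition nat_bits (n : nat) : seq bool :=
  if bin_of_nat n is Npos p then pos_bits p else [::].

(* All the encodings below are prefix-free, hence injective. *)

Definition enc_nat (n : nat) : seq sym := rcons (map Bit (nat_bits n)) Sep.

Definition enc_seq (T : Type) (enc : T -> seq sym) (s : seq T) : seq sym :=
  Open :: rcons (flatten (map enc s)) Close.

Definition enc_order (p : order) : seq sym := enc_seq enc_nat p.

Definition enc_vote (v : vote) : seq sym := enc_nat v.1 ++ enc_order v.2.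

Definition enc_dv_past (e : voter * option order) : seq sym :=
  enc_nat e.1 ++
  match e.2 with
  | None => [:: Bit true]
  | Some p => Bit false :: enc_order p
  end.

Definition enc_dv (I : dv_instance) : seq sym :=
  enc_seq enc_nat (dv_candidates I) ++ enc_seq enc_dv_past (dv_past I) ++
  enc_vote (dv_current I) ++ enc_seq enc_nat (dv_future I) ++
  enc_order (dv_chair I) ++ enc_nat (dv_dist I) ++ enc_nat (dv_limit I).

Definition enc_av_past (e : voter * past_status) : seq sym :=
  enc_nat e.1 ++
  match e.2 with
  | Registered p => Bit true :: enc_order p
  | Added p => [:: Bit false, Bit true & enc_order p]
  | NotAdded => [:: Bit false; Bit false]
  end.

Definition enc_av_future (e : voter * bool) : seq sym :=
  rcons (enc_nat e.1) (Bit e.2).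

Definition enc_av (I : av_instance) : seq sym :=
  enc_seq enc_nat (av_candidates I) ++ enc_seq enc_av_past (av_past I) ++
  enc_vote (av_current I) ++ enc_seq enc_av_future (av_future I) ++
  enc_order (av_chair I) ++ enc_nat (av_dist I) ++ enc_nat (av_limit I).

(** * The problems *)

Definition online_plurality_DV (g : control) : language sym :=
  fun w => exists I, [/\ w = enc_dv I, dv_wf I & dv_yes g I].

Definition online_plurality_AV (g : control) : language sym :=
  fun w => exists I, [/\ w = enc_av I, av_wf I & av_yes g I].

Definition online_plurality_CCDV := online_plurality_DV Constructive.
Definition online_plurality_DCDV := online_plurality_DV Destructive.
Definition online_plurality_CCAV := online_plurality_AV Constructive.
Definition online_plurality_DCAV := online_plurality_AV Destructive.

(* Main.v *)
From mathcomp Require Import all_boot.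
From mathcomp Require Import zify.
Require Import Defs.

(* The games have closed forms.  Call a candidate good or bad according to the
   side of [d] on which the chair puts her, and let the margin be 0 in the
   constructive case and 1 in the destructive case: the chair reaches her goal
   iff every bad candidate is behind some good one by at least the margin.  The
   worst future voters all vote for a strongest bad candidate.  When deleting,
   the chair wins against them iff every bad score is behind some good score by
   the margin, and remains so after adding the number of future voters and
   subtracting the number of deletions left.  When adding, only the registered
   future voters count.  It remains to try both actions for the current voter.

   For the time bounds, the tapes of a Turing machine serve as stacks, on which
   binary trees are kept in Polish notation.  The functions on trees that are
   computable in polynomial time are closed under the usual constructions and
   under folding along a list whenever all the intermediate results have
   polynomial size; this covers parsing and the evaluation of the closed forms. *)

(** A direct evaluation of the games ranges over all future votes, and the limit is written in
    binary, so it may be exponential in the length of the input. The closed forms involve only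
    scores and numbers of voters, which can be kept in unary, and the limit is only ever compared
    with such numbers. They rest on two remarks. A deletion is needed only when a vote for a bad
    candidate meets no good candidate with slack. An unregistered voter can always be left out, and
    in the worst case she votes for the bad candidate that matters. Polish notation is chosen
    because a counter suffices to find the end of a tree, so that trees lie on the main stack one
    after another without separators. The size condition on folds is essential: mere doubling along
    a list already produces exponential size. Since the languages contain nothing but encodings of
    well-formed instances, the parsers have to be exact, down to the rejection of numerals with
    leading zeros. *)

Set Implicit Arguments.
Unset Strict Implicit.
Unset Printing Implicit Defensive.


(** * Structured programs on stacks *)

Section Programs.
Variables (S : finType) (K : nat).

(* [None] keeps the stack, [Some None] pops it and [Some (Some a)] pushes [a]. *)
Definition stack_op : Type := option (option S).

Definition do_op (o : stack_op) (s : seq S) : seq S :=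
  match o with
  | None => s
  | Some None => behead s
  | Some (Some a) => a :: s
  end.

Inductive cmd :=
  | Act of (seq (option S) -> seq stack_op)
  | Seq of cmd & cmd
  | If of (seq (option S) -> bool) & cmd & cmd
  | While of (seq (option S) -> bool) & cmd.

Definition tops (s : seq (seq S)) : seq (option S) :=
  mkseq (fun j => ohead (nth [::] s j)) K.

Definition do_ops (os : seq stack_op) (s : seq (seq S)) : seq (seq S) :=
  mkseq (fun j => do_op (nth None os j) (nth [::] s j)) K.

(* The last argument is the number of steps of the Turing machine below. *)
Inductive exec : cmd -> seq (seq S) -> seq (seq S) -> nat -> Prop :=
  | ExecAct f s : exec (Act f) s (do_ops (f (tops s)) s) 2
  | ExecSeq c1 c2 s s1 s2 n1 n2 :
      exec c1 s s1 n1 -> exec c2 s1 s2 n2 -> exec (Seq c1 c2) s s2 (n1 + n2)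
  | ExecIf t c1 c2 s s' n :
      exec (if t (tops s) then c1 else c2) s s' n -> exec (If t c1 c2) s s' n.+1
  | ExecDone t c s : t (tops s) = false -> exec (While t c) s s 1
  | ExecLoop t c s s1 s2 n1 n2 : t (tops s) = true ->
      exec c s s1 n1 -> exec (While t c) s1 s2 n2 ->
      exec (While t c) s s2 (n1 + n2).+1.

Lemma exec_if (t : seq (option S) -> bool) c1 c2 s s' n b :
  t (tops s) = b -> exec (if b then c1 else c2) s s' n ->
  exec (If t c1 c2) s s' n.+1.
Proof. by move=> <-; apply: ExecIf. Qed.

Lemma exec_act f s s' : do_ops (f (tops s)) s = s' -> exec (Act f) s s' 2.
Proof. by move=> <-; apply: ExecAct. Qed.

(** * Compilation to Turing machines *)

(** States are program points. A push has to move the head before it can write, so an [Act] takes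
    two steps, and its second state remembers the letters to write. In [If] and [While] the state
    [None] is the one that evaluates the test. *)
Fixpoint cstate (c : cmd) : finType :=
  match c with
  | Act _ => option {ffun 'I_K -> option S}
  | Seq c1 c2 => (cstate c1 + cstate c2)%type
  | If _ c1 c2 => option (cstate c1 + cstate c2)
  | While _ c1 => option (cstate c1)
  end.

Fixpoint cstart (c : cmd) : cstate c :=
  match c with
  | Act _ => None
  | Seq c1 _ => inl (cstart c1)
  | If _ _ _ => None
  | While _ _ => None
  end.

Definition scans : Type := {ffun 'I_K -> option S}.
Definition actions : Type := {ffun 'I_K -> option S * move}.
Definition tapes : Type := {ffun 'I_K -> tape S}.

Definition scan_seq (sc : scans) : seq (option S) := [seq sc j | j <- enum 'I_K].

Definition idle (sc : scans) : actions := [ffun j => (sc j, MoveS)].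

Definition first_action (sc : scans) (os : seq stack_op) : actions :=
  [ffun j : 'I_K => match nth None os j with
           | None => (sc j, MoveS)
           | Some None => (None, MoveR)
           | Some (Some _) => (sc j, MoveL)
           end].

Definition pending (os : seq stack_op) : {ffun 'I_K -> option S} :=
  [ffun j : 'I_K => if nth None os j is Some (Some a) then Some a else None].

Definition second_action (sc : scans) (w : {ffun 'I_K -> option S}) : actions :=
  [ffun j => (if w j is Some a then Some a else sc j, MoveS)].

(* The result [None] means that the program has been left. *)
Fixpoint cstep (c : cmd) : cstate c -> scans -> option (cstate c) * actions :=
  match c return cstate c -> scans -> option (cstate c) * actions with
  | Act f => fun x sc =>
      match x with
      | None => let os := f (scan_seq sc) in
                (Some (Some (pending os)), first_action sc os)
      | Some w => (None, second_action sc w)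
      end
  | Seq c1 c2 => fun x sc =>
      match x with
      | inl y => let r := cstep y sc in
          (Some (if r.1 is Some y' then inl y' else inr (cstart c2)), r.2)
      | inr y => let r := cstep y sc in (omap inr r.1, r.2)
      end
  | If t c1 c2 => fun x sc =>
      match x with
      | None => (Some (Some (if t (scan_seq sc) then inl (cstart c1)
                             else inr (cstart c2))), idle sc)
      | Some (inl y) =>
          let r := cstep y sc in (omap (fun z => Some (inl z)) r.1, r.2)
      | Some (inr y) =>
          let r := cstep y sc in (omap (fun z => Some (inr z)) r.1, r.2)
      end
  | While t c1 => fun x sc =>
      match x with
      | None => (if t (scan_seq sc) then Some (Some (cstart c1)) else None,
                 idle sc)
      | Some y => let r := cstep y sc in (Some r.1, r.2)
      end
  end.

Definition scan (T : tapes) : scans := [ffun j => scanned (T j)].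

Definition act_on (a : actions) (T : tapes) : tapes :=
  [ffun j => move_head (a j).2 (write (a j).1 (T j))].

(** Leaving the program counts as a step, the one that passes control to the successor; this is why
    step counts simply add up under composition. *)
Inductive reach (c : cmd) : cstate c -> tapes -> tapes -> nat -> Prop :=
  | ReachExit x T a : cstep x (scan T) = (None, a) -> reach x T (act_on a T) 1
  | ReachStep x y T T' a n : cstep x (scan T) = (Some y, a) ->
      reach y (act_on a T) T' n -> reach x T T' n.+1.

(** The top is under the head and the stack extends to the right. Explicit blanks are allowed at
    both ends, as a pop leaves one on the left and a push onto the empty stack leaves one on the
    right. *)
Definition is_stack (t : tape S) (s : seq S) : Prop :=
  [/\ scanned t = ohead s,
      exists n, rcells t = map Some (behead s) ++ nseq n None
    & exists n, lcells t = nseq n None].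

Definition represents (T : tapes) (s : seq (seq S)) : Prop :=
  forall j : 'I_K, is_stack (T j) (nth [::] s j).

Lemma scan_represents T s : represents T s -> scan_seq (scan T) = tops s.
Proof.
move=> rT; rewrite /scan_seq /tops /mkseq -val_enum_ord -map_comp.
by apply: eq_map => j; rewrite /scan ffunE; case: (rT j).
Qed.

Lemma act_on_idle T : act_on (idle (scan T)) T = T.
Proof. by apply/ffunP => j; rewrite !ffunE /=; case: (T j). Qed.

Lemma reach_act f T s : represents T s ->
  exists2 T', represents T' (do_ops (f (tops s)) s) & reach (cstart (Act f)) T T' 2.
Proof.
move=> rT; set os := f (tops s).
set T1 := act_on (first_action (scan T) os) T.
exists (act_on (second_action (scan T1) (pending os)) T1); last first.
  apply: (@ReachStep (Act f) _ (Some (pending os)) _ _ (first_action (scan T) os)).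
    by rewrite /= (scan_represents rT).
  exact: ReachExit.
move=> j; rewrite /do_ops nth_mkseq ?ltn_ord //.
rewrite /T1 /act_on /second_action /first_action /pending /scan !ffunE /=.
have [eh [n er] [m el]] := rT j.
case: (nth None os j) => [[a|]|] /=.
- split=> //=; last by rewrite el; case: m {el} => [|m]; [exists 0|exists m].
  rewrite er eh; case: (nth [::] s j) => [|b x] /=; last by exists n.
  by exists n.+1.
- rewrite er el; split=> /=.
  + by case: (nth [::] s j) => [|b [|b' x]] //=; case: (n).
  + case: (nth [::] s j) => [|b [|b' x]] //=; last by exists n.
    * by exists n.-1; case: (n).
    * by exists n.-1; case: (n).
  + by exists m.+1.
- split=> //; first by exists n.
  by exists m.
Qed.

Lemma reach_seq_r c1 c2 (x : cstate c2) T T' n :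
  reach x T T' n -> @reach (Seq c1 c2) (inr x) T T' n.
Proof.
elim=> {x T T' n} [x T a e|x y T T' a n e _ IH].
  by apply: ReachExit; rewrite /= e.
by apply: ReachStep IH; rewrite /= e.
Qed.

Lemma reach_seq_l c1 c2 (x : cstate c1) T T1 T2 n1 n2 :
  reach x T T1 n1 -> reach (cstart c2) T1 T2 n2 ->
  @reach (Seq c1 c2) (inl x) T T2 (n1 + n2).
Proof.
move=> r1 r2; elim: r1 r2 => {x T T1 n1} [x T a e|x y T T' a n e _ IH] r2.
  by apply: ReachStep (reach_seq_r _ r2); rewrite /= e.
by apply: ReachStep (IH r2); rewrite /= e.
Qed.

Lemma reach_if_l t c1 c2 (x : cstate c1) T T' n :
  reach x T T' n -> @reach (If t c1 c2) (Some (inl x)) T T' n.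
Proof.
elim=> {x T T' n} [x T a e|x y T T' a n e _ IH].
  by apply: ReachExit; rewrite /= e.
by apply: ReachStep IH; rewrite /= e.
Qed.

Lemma reach_if_r t c1 c2 (x : cstate c2) T T' n :
  reach x T T' n -> @reach (If t c1 c2) (Some (inr x)) T T' n.
Proof.
elim=> {x T T' n} [x T a e|x y T T' a n e _ IH].
  by apply: ReachExit; rewrite /= e.
by apply: ReachStep IH; rewrite /= e.
Qed.

Lemma reach_while t c (x : cstate c) T T1 T2 n1 n2 :
  reach x T T1 n1 -> reach (cstart (While t c)) T1 T2 n2 ->
  @reach (While t c) (Some x) T T2 (n1 + n2).
Proof.
move=> r1 r2; elim: r1 r2 => {x T T1 n1} [x T a e|x y T T' a n e _ IH] r2.
  by apply: ReachStep r2; rewrite /= e.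
by apply: ReachStep (IH r2); rewrite /= e.
Qed.

Lemma exec_reach c s s' n T : exec c s s' n -> represents T s ->
  exists2 T', represents T' s' & reach (cstart c) T T' n.
Proof.
move=> ex; elim: ex T => {c s s' n}
  [f s|c1 c2 s s1 s2 n1 n2 _ IH1 _ IH2|t c1 c2 s s' n _ IH|t c s e
  |t c s s1 s2 n1 n2 e _ IH1 _ IH2] T rT.
- exact: reach_act.
- have [T1 rT1 r1] := IH1 _ rT; have [T2 rT2 r2] := IH2 _ rT1.
  by exists T2 => //; apply: reach_seq_l r1 r2.
- have [T' rT' r] := IH _ rT; exists T' => //.
  apply: (ReachStep (a := idle (scan T))); first by [].
  rewrite act_on_idle (scan_represents rT).
  by case: (t (tops s)) r; [apply: reach_if_l|apply: reach_if_r].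
- exists T => //; rewrite -{2}(act_on_idle T); apply: ReachExit.
  by rewrite /= (scan_represents rT) e.
- have [T1 rT1 r1] := IH1 _ rT; have [T2 rT2 r2] := IH2 _ rT1.
  exists T2 => //; apply: (ReachStep (a := idle (scan T))).
    by rewrite /= (scan_represents rT) e.
  by rewrite act_on_idle; apply: reach_while r1 r2.
Qed.

End Programs.

(** * The Turing machine of a program, with its verdict *)

Section Machine.
Variables (Sigma Work : finType) (k : nat).
Local Notation S := (Sigma + Work)%type.
Variables (c : cmd S) (accept : seq (option S) -> bool).

Definition machine : turing_machine Sigma :=
  @TuringMachine Sigma k Work (cstate k.+1 c + option bool)%type
    (inl (cstart k.+1 c)) (fun q => if q is inr b then b else None)
    (fun q sc => match q with
     | inl x => let r := cstep x sc in
                (if r.1 is Some y then inl y else inr None, r.2)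
     | inr _ => (inr (Some (accept (scan_seq sc))), idle sc)
     end).

Lemma reach_iter (x : cstate k.+1 c) T T' n : reach x T T' n ->
  iter n (@step _ machine) (inl x, T) = (inr None, T').
Proof.
elim=> {x T T' n} [x T a e|x y T T' a n e _ IH].
  rewrite /= /step /=.
  by rewrite -/(scan T) e.
by rewrite iterSr {2}/step /= -/(scan T) e.
Qed.

(** After the program is left, one more step reads the tops of the stacks to find the verdict; hence
    the strict inequality. *)
Lemma machine_answer w s n t :
  exec k.+1 c (map inl w :: nseq k [::]) s n -> n < t ->
  answer_within machine t w = Some (accept (tops k.+1 s)).
Proof.
move=> ex lt_nt.
have [|T' rT' r] := exec_reach (T := (init machine w).2) ex.
  move=> j; rewrite ffunE; case: eqP => [->|nj] /=.
    split; last by exists 0.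
    - by case: w {ex}.
    - by exists 0; case: w {ex} => //= a w; rewrite cats0.
  have -> : nth [::] (map inl w :: nseq k [::]) j = [::] :> seq S.
    case: j nj => [[|j] lt_j] nj; first by case: nj; apply: val_inj.
    by rewrite /= nth_nseq if_same.
  by split=> //; exists 0.
(* The time splits into [n] steps of the program, one step for the verdict, and idle steps in a
   configuration fixed by [step]. *)
rewrite /answer_within -(subnK lt_nt) iterD iterS.
rewrite [init _ _]surjective_pairing (reach_iter r).
have -> : @step _ machine (inr None, T') = (inr (Some (accept (tops k.+1 s))), T').
  rewrite /step /= -/(scan T') (scan_represents rT'); congr pair.
  exact: act_on_idle.
by rewrite iter_fix.
Qed.

End Machine.


(** * Polynomial bounds *)

Lemma leq_pow e m n : m <= n -> m ^ e <= n ^ e.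
Proof. by case: e => // e; rewrite leq_exp2r. Qed.

(* The base [n + 2] absorbs constants, so one exponent describes a bound. *)
Definition pbound (g : nat -> nat) : Prop := exists e, forall n, g n <= (n + 2) ^ e.

Lemma pbound_const c : pbound (fun=> c).
Proof.
exists c => n; apply: leq_trans (leq_pow c (leq_addl n 2)).
elim: c => // c IH; rewrite -{1}add1n expnS mul2n -addnn.
by apply: leq_add => //; rewrite expn_gt0.
Qed.

Lemma pbound_id : pbound id.
Proof. by exists 1 => n; rewrite expn1 leq_addr. Qed.

Lemma pbound_add g h : pbound g -> pbound h -> pbound (fun n => g n + h n).
Proof.
(* The additional factor [n + 2] is at least 2 and pays for the sum of two powers. *)
move=> [d gd] [e he]; exists (maxn d e).+1 => n; rewrite expnS.
have gt0 : 0 < n + 2 by rewrite addn2.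
have := leq_trans (gd n) (leq_pexp2l gt0 (leq_maxl d e)).
have := leq_trans (he n) (leq_pexp2l gt0 (leq_maxr d e)).
by nia.
Qed.

Lemma pbound_mul g h : pbound g -> pbound h -> pbound (fun n => g n * h n).
Proof.
by move=> [d gd] [e he]; exists (d + e) => n; rewrite expnD leq_mul.
Qed.

Lemma pbound_exp g e : pbound g -> pbound (fun n => g n ^ e).
Proof.
move=> [d gd]; exists (d * e) => n; rewrite expnM; case: e => // e.
by rewrite leq_exp2r.
Qed.

Ltac pbound := solve [repeat first
  [ assumption | apply: pbound_const | apply: pbound_id | apply: pbound_add
  | apply: pbound_mul | apply: pbound_exp]].

(** * Binary trees on a stack *)

Inductive tree := Leaf | Node of tree & tree.

Fixpoint polish (t : tree) : seq bool :=
  match t with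
  | Leaf => [:: false]
  | Node t1 t2 => true :: polish t1 ++ polish t2
  end.

Definition tsize (t : tree) : nat := size (polish t).

Lemma tsize_node t1 t2 : tsize (Node t1 t2) = (tsize t1 + tsize t2).+1.
Proof. by rewrite /tsize /= size_cat. Qed.

Lemma tsize_gt0 t : 0 < tsize t.
Proof. by case: t. Qed.

(** The work alphabet has two bits for Polish notation and a mark, which bounds from below a word
    that is set aside on an auxiliary stack. *)
Definition letter : finType := (sym + option bool)%type.
Definition bit (b : bool) : letter := inr (Some b).
Definition mark : letter := inr None.

Definition word (t : tree) : seq letter := map bit (polish t).

Lemma size_word t : size (word t) = tsize t.
Proof. by rewrite size_map. Qed.

Lemma word_node t1 t2 : word (Node t1 t2) = bit true :: word t1 ++ word t2.
Proof. by rewrite /word /= map_cat. Qed.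

Definition ex (c : cmd letter) (s s' : seq (seq letter)) (b : nat) : Prop :=
  exists2 n, n <= b & exec 5 c s s' n.

Lemma ex_seq c1 c2 s s1 s2 b1 b2 :
  ex c1 s s1 b1 -> ex c2 s1 s2 b2 -> ex (Seq c1 c2) s s2 (b1 + b2).
Proof.
move=> [n1 le1 ex1] [n2 le2 ex2]; exists (n1 + n2); first exact: leq_add.
exact: ExecSeq ex1 ex2.
Qed.

Lemma ex_act f s s' : do_ops 5 (f (tops 5 s)) s = s' -> ex (Act f) s s' 2.
Proof. by move=> e; exists 2 => //; apply: exec_act. Qed.

Lemma ex_if (t : seq (option letter) -> bool) c1 c2 s s' n b :
  t (tops 5 s) = b -> ex (if b then c1 else c2) s s' n ->
  ex (If t c1 c2) s s' n.+1.
Proof. by move=> e [k le_k h]; exists k.+1 => //; apply: exec_if e h. Qed.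

Lemma ex_done t c s : t (tops 5 s) = false -> ex (While t c) s s 1.
Proof. by move=> e; exists 1 => //; apply: ExecDone. Qed.

Lemma ex_loop t c s s1 s2 b1 b2 : t (tops 5 s) = true ->
  ex c s s1 b1 -> ex (While t c) s1 s2 b2 -> ex (While t c) s s2 (b1 + b2).+1.
Proof.
move=> e [n1 le1 ex1] [n2 le2 ex2]; exists (n1 + n2).+1.
  by rewrite ltnS leq_add.
exact: ExecLoop e ex1 ex2.
Qed.

Lemma ex_le c s s' b b' : ex c s s' b -> b <= b' -> ex c s s' b'.
Proof. by move=> [n le_n h] le_b; exists n => //; apply: leq_trans le_b. Qed.

(* The stacks are the input, the main stack, two auxiliary stacks and a unary
   counter, which is empty between the basic operations below. *)
Definition Push (j : nat) (a : letter) : cmd letter :=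
  Act (fun=> ncons j None [:: Some (Some a)]).
Definition Pop (j : nat) : cmd letter := Act (fun=> ncons j None [:: Some None]).

Definition copy_op (o : option letter) : stack_op letter := omap Some o.

(* The counter holds the number of trees that are still to be read. *)
Definition take_ops (dA dB : bool) (t : seq (option letter)) :
    seq (stack_op letter) :=
  let x := nth None t 1 in
  [:: None; Some None; if dA then copy_op x else None;
      if dB then copy_op x else None;
      if x is Some (inr (Some true)) then Some (Some (bit true)) else Some None].

Definition take_loop dA dB : cmd letter :=
  While (fun t => isSome (nth None t 4)) (Act (take_ops dA dB)).

Definition Take (dA dB : bool) : cmd letter :=
  Seq (Act (fun=> [:: None; None; if dA then Some (Some mark) else None;
                      if dB then Some (Some mark) else None;
                      Some (Some (bit true))]))
      (take_loop dA dB).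

(** A node turns one expected tree into two, a leaf completes one. The rest of the run is a
    hypothesis, so that the runs on the two subtrees can be chained in the induction. Each letter
    costs one step for the test and two for the action. *)
Lemma take_loop_spec dA dB t i m a b j s n :
  ex (take_loop dA dB)
     [:: i; m; if dA then catrev (word t) a else a;
         if dB then catrev (word t) b else b; nseq j (bit true)] s n ->
  ex (take_loop dA dB) [:: i; word t ++ m; a; b; nseq j.+1 (bit true)] s
     (3 * tsize t + n).
Proof.
elim: t m a b j n => [|t1 IH1 t2 IH2] m a b j n h.
  apply: (ex_loop _ (ex_act (erefl _))) => //.
  by move: h; rewrite /do_ops /mkseq /=; clear; case: dA; case: dB.
have -> : 3 * tsize (Node t1 t2) + n = (2 + (3 * tsize t1 + (3 * tsize t2 + n))).+1.
  by rewrite tsize_node; lia.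
apply: (ex_loop _ (ex_act (erefl _))) => //.
rewrite /do_ops /mkseq /= map_cat -catA.
apply: (IH1 _ _ _ j.+1); apply: (IH2 _ _ _ j).
by move: h; rewrite word_node; clear; case: dA; case: dB; rewrite /= ?catrev_catl.
Qed.

Lemma Take_spec dA dB t i m a b :
  ex (Take dA dB) [:: i; word t ++ m; a; b; [::]]
     [:: i; m; if dA then catrev (word t) (mark :: a) else a;
         if dB then catrev (word t) (mark :: b) else b; [::]]
     (3 * tsize t + 3).
Proof.
have -> : 3 * tsize t + 3 = 2 + (3 * tsize t + 1) by lia.
apply: (ex_seq (ex_act (erefl _))).
rewrite /do_ops /mkseq /=; apply: (@take_loop_spec _ _ _ _ _ _ _ 0) => /=.
by have := @ex_done (fun t => isSome (nth None t 4)) (Act (take_ops dA dB));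
  case: dA; case: dB; apply.
Qed.

Definition is_bit (o : option letter) : bool :=
  if o is Some (inr (Some _)) then true else false.

Definition BackA : cmd letter :=
  Seq (While (fun t => is_bit (nth None t 2))
         (Act (fun t => [:: None; copy_op (nth None t 2); Some None])))
      (Pop 2).

Definition BackB : cmd letter :=
  Seq (While (fun t => is_bit (nth None t 3))
         (Act (fun t => [:: None; copy_op (nth None t 3); None; Some None])))
      (Pop 3).

(** Undoes [Take]: moving the letters down to the mark reverses the word a second time. *)
Lemma BackA_spec t i m a b :
  ex BackA [:: i; m; catrev (word t) (mark :: a); b; [::]]
     [:: i; word t ++ m; a; b; [::]] (3 * tsize t + 3).
Proof.
have -> : 3 * tsize t + 3 = 3 * tsize t + 1 + 2 by lia.
rewrite catrevE /word -map_rev /tsize -size_rev.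
rewrite -[X in map bit X ++ m]revK [map bit (rev (rev _))]map_rev -catrevE.
elim: (rev (polish t)) m => [|x v IH] m.
  apply: (@ex_seq _ _ _ [:: i; m; mark :: a; b; [::]]); last by apply: ex_act.
  by apply: ex_done.
have [n le_n h] := IH (bit x :: m); exists (n + 3) => /=.
  by move: le_n; rewrite /=; lia.
(* The induction hypothesis runs the loop and then [Pop 2]; it is split so that one more iteration
   can be put in front of the loop. *)
inversion h as [|? ? ? s1 ? n1 n2 h1 h2| | |]; subst.
rewrite -addnA [n2 + 3]addnC addnA; apply: ExecSeq h2.
have -> : n1 + 3 = (2 + n1).+1 by lia.
by apply: ExecLoop h1 => //; apply: exec_act.
Qed.

Lemma BackB_spec t i m a b :
  ex BackB [:: i; m; a; catrev (word t) (mark :: b); [::]]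
     [:: i; word t ++ m; a; b; [::]] (3 * tsize t + 3).
Proof.
have -> : 3 * tsize t + 3 = 3 * tsize t + 1 + 2 by lia.
rewrite catrevE /word -map_rev /tsize -size_rev.
rewrite -[X in map bit X ++ m]revK [map bit (rev (rev _))]map_rev -catrevE.
elim: (rev (polish t)) m => [|x v IH] m.
  apply: (@ex_seq _ _ _ [:: i; m; a; mark :: b; [::]]); last by apply: ex_act.
  by apply: ex_done.
have [n le_n h] := IH (bit x :: m); exists (n + 3) => /=.
  by move: le_n; rewrite /=; lia.
inversion h as [|? ? ? s1 ? n1 n2 h1 h2| | |]; subst.
rewrite -addnA [n2 + 3]addnC addnA; apply: ExecSeq h2.
have -> : n1 + 3 = (2 + n1).+1 by lia.
by apply: ExecLoop h1 => //; apply: exec_act.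
Qed.

Definition Drop : cmd letter := Take false false.

Lemma Drop_spec t i m a b :
  ex Drop [:: i; word t ++ m; a; b; [::]] [:: i; m; a; b; [::]] (3 * tsize t + 3).
Proof. exact: Take_spec. Qed.

Definition Copy : cmd letter := Seq (Take true true) (Seq BackA BackB).

Lemma Copy_spec t i m a b :
  ex Copy [:: i; word t ++ m; a; b; [::]]
     [:: i; word t ++ word t ++ m; a; b; [::]] (9 * tsize t + 9).
Proof.
eapply ex_le.
  exact: ex_seq (Take_spec true true _ _ _ _ _)
    (ex_seq (BackA_spec _ _ _ _ _) (BackB_spec _ _ _ _ _)).
by lia.
Qed.

Definition Swap : cmd letter :=
  Seq (Take true false) (Seq (Take false true) (Seq BackA BackB)).

Lemma Swap_spec t u i m a b :
  ex Swap [:: i; word t ++ word u ++ m; a; b; [::]]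
     [:: i; word u ++ word t ++ m; a; b; [::]] (6 * tsize t + 6 * tsize u + 12).
Proof.
eapply ex_le.
  exact: ex_seq (Take_spec true false _ _ _ _ _)
    (ex_seq (Take_spec false true _ _ _ _ _)
    (ex_seq (BackA_spec _ _ _ _ _) (BackB_spec _ _ _ _ _))).
by lia.
Qed.

(** * Programs on trees *)

(** Everything below the argument is arbitrary and preserved, so a program is a subroutine on the
    top of the main stack. One exponent bounds both time and output size; the latter is what makes
    composition polynomial. *)
Definition run (c : cmd letter) (e : nat) (t u : tree) : Prop :=
  tsize u <= (tsize t + 2) ^ e /\
  forall i m a b, ex c [:: i; word t ++ m; a; b; [::]]
                     [:: i; word u ++ m; a; b; [::]] ((tsize t + 2) ^ e).

Definition PairP (c1 c2 : cmd letter) : cmd letter :=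
  Seq Copy (Seq c1 (Seq Swap (Seq c2 (Seq Swap (Push 1 (bit true)))))).

Lemma run_pair c1 c2 e1 e2 : exists e, forall t u v,
  run c1 e1 t u -> run c2 e2 t v -> run (PairP c1 c2) e t (Node u v).
Proof.
have [e be] : pbound (fun n => 100 * n + 100 + 20 * (n + 2) ^ e1 + 20 * (n + 2) ^ e2).
  by pbound.
exists e => t u v [su ru] [sv rv]; split.
  by apply: leq_trans (be _); rewrite tsize_node; lia.
move=> i m a b; apply: (ex_le _ (be _)); rewrite word_node.
apply: ex_le (ex_seq (Copy_spec _ _ _ _ _) (ex_seq (ru _ _ _ _)
  (ex_seq (Swap_spec _ _ _ _ _ _) (ex_seq (rv _ _ _ _)
  (ex_seq (Swap_spec _ _ _ _ _ _) (ex_act _)))))) _; last by lia.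
by rewrite /do_ops /mkseq /= catA.
Qed.

Definition FstP : cmd letter :=
  Seq (Pop 1) (Seq (Take true false) (Seq Drop BackA)).

Lemma run_fst : exists e, forall t u, run FstP e (Node t u) t.
Proof.
have [e be] : pbound (fun n => 10 * n + 20) by pbound.
exists e => t u; split.
  by apply: leq_trans (be _); rewrite tsize_node; lia.
move=> i m a b; apply: (ex_le _ (be _)); rewrite word_node.
apply: ex_le (ex_seq (ex_act (erefl _))
  (ex_seq (s1 := [:: i; word u ++ m; catrev (word t) (mark :: a); b; [::]]) _
  (ex_seq (Drop_spec _ _ _ _ _) (BackA_spec _ _ _ _ _)))) _.
  by rewrite /do_ops /mkseq /= -catA; apply: (Take_spec true false).
by rewrite tsize_node; lia.
Qed.

Definition SndP : cmd letter := Seq (Pop 1) Drop.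

Lemma run_snd : exists e, forall t u, run SndP e (Node t u) u.
Proof.
have [e be] : pbound (fun n => 10 * n + 20) by pbound.
exists e => t u; split.
  by apply: leq_trans (be _); rewrite tsize_node; lia.
move=> i m a b; apply: (ex_le _ (be _)); rewrite word_node.
apply: ex_le (ex_seq (b2 := 3 * tsize t + 3) (ex_act (erefl _)) _) _.
  by rewrite /do_ops /mkseq /= -catA; apply: Drop_spec.
by rewrite tsize_node; lia.
Qed.

Lemma run_comp c1 c2 e1 e2 : exists e, forall t u v,
  run c1 e1 t u -> run c2 e2 u v -> run (Seq c1 c2) e t v.
Proof.
have [e be] : pbound (fun n => (n + 2) ^ e1 + ((n + 2) ^ e1 + 2) ^ e2) by pbound.
exists e => t u v [su ru] [sv rv].
have le2 : (tsize u + 2) ^ e2 <= ((tsize t + 2) ^ e1 + 2) ^ e2.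
  by apply: leq_pow; rewrite leq_add2r.
split; first by apply: leq_trans (be _); lia.
move=> i m a b; apply: (ex_le _ (be _)).
by apply: ex_le (ex_seq (ru _ _ _ _) (rv _ _ _ _)) _; lia.
Qed.

Definition SkipP : cmd letter := Act (fun=> [::]).

Lemma run_id : exists e, forall t, run SkipP e t t.
Proof.
have [e be] : pbound (fun n => n + 2) by pbound.
exists e => t; split; first by apply: leq_trans (be _); lia.
move=> i m a b; apply: (ex_le _ (be _)).
by apply: ex_le (ex_act (erefl _)) _; lia.
Qed.

Definition push_all (w : seq letter) : cmd letter :=
  foldr (fun x c => Seq c (Push 1 x)) SkipP w.

Lemma push_all_spec w i m a b c : 
  ex (push_all w) [:: i; m; a; b; c] [:: i; w ++ m; a; b; c] (2 * size w + 2).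
Proof.
elim: w m => [|x w IH] m; first exact: ex_act.
by apply: ex_le (ex_seq (IH _) (ex_act (erefl _))) _; rewrite /=; lia.
Qed.

Definition ConstP (u : tree) : cmd letter := Seq Drop (push_all (word u)).

Lemma run_const u : exists e, forall t, run (ConstP u) e t u.
Proof.
have [e be] : pbound (fun n => 3 * n + 2 * tsize u + 5) by pbound.
exists e => t; split; first by apply: leq_trans (be _); lia.
move=> i m a b; apply: (ex_le _ (be _)).
apply: ex_le (ex_seq (Drop_spec _ _ _ _ _) (push_all_spec _ _ _ _ _ _)) _.
by rewrite size_word; lia.
Qed.

Definition is_node (t : seq (option letter)) : bool :=
  if nth None t 1 is Some (inr (Some true)) then true else false.

Definition CaseP (c c1 c2 : cmd letter) : cmd letter :=
  Seq Copy (Seq c (If is_node (Seq Drop c2) (Seq Drop c1))).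

(** Correctness is demanded only of the branch selected by [v]; thus a branch may be meaningful for
    nonempty lists alone. *)
Lemma run_case c c1 c2 e e1 e2 : exists f, forall t v w,
  run c e t v ->
  match v with Leaf => run c1 e1 t w | Node _ _ => run c2 e2 t w end ->
  run (CaseP c c1 c2) f t w.
Proof.
have [f bf] : pbound (fun n => 9 * n + 20 + 4 * (n + 2) ^ e + (n + 2) ^ e1 +
  (n + 2) ^ e2) by pbound.
exists f => t v w [sv rv] h.
have [sw rw] : tsize w <= (tsize t + 2) ^ e1 + (tsize t + 2) ^ e2 /\
  forall i m a b, ex (If is_node (Seq Drop c2) (Seq Drop c1))
    [:: i; word v ++ word t ++ m; a; b; [::]] [:: i; word w ++ m; a; b; [::]]
    (3 * tsize v + 4 + (tsize t + 2) ^ e1 + (tsize t + 2) ^ e2).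
  case: v {sv rv} h => [|v1 v2] [sw rw]; (split=> [|i m a b]; first by lia).
    eapply ex_le.
      apply: (ex_if (b := false)) => //=.
      exact: ex_seq (Drop_spec Leaf _ _ _ _) (rw _ _ _ _).
    by lia.
  eapply ex_le.
    apply: (ex_if (b := true)) => //=.
    exact: ex_seq (Drop_spec (Node v1 v2) _ _ _ _) (rw _ _ _ _).
  by lia.
split; first by apply: leq_trans (bf _); lia.
move=> i m a b; apply: (ex_le _ (bf _)).
apply: ex_le (ex_seq (Copy_spec _ _ _ _ _)
  (ex_seq (rv _ _ _ _) (rw _ _ _ _))) _.
by lia.
Qed.

(** The length of a list when the tree is read as one; any list can thus serve as a unary loop
    counter. *)
Fixpoint spine (t : tree) : nat := if t is Node _ t' then (spine t').+1 else 0.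

Lemma spine_le t : spine t <= tsize t.
Proof. by elim: t => // t1 _ t2 IH; rewrite tsize_node /=; lia. Qed.

Definition iter_loop (c : cmd letter) : cmd letter :=
  While is_node (Seq (Pop 1) (Seq Drop (Seq (Take true false) (Seq c BackA)))).

Definition IterP (c : cmd letter) : cmd letter :=
  Seq (Pop 1) (Seq (iter_loop c) (Pop 1)).

(** The common bound [b] on the intermediate values makes every round cost the same polynomial in
    [b], whatever the growth that [c] alone would permit. *)
Lemma iter_loop_spec c e b n (y : nat -> tree) i m a a' :
  (forall j, j < spine n -> run c e (y j) (y j.+1)) ->
  (forall j, j <= spine n -> tsize (y j) <= b) ->
  ex (iter_loop c) [:: i; word n ++ word (y 0) ++ m; a; a'; [::]]
     [:: i; bit false :: word (y (spine n)) ++ m; a; a'; [::]]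
     (spine n * (9 * tsize n + 20 + (b + 2) ^ e) + 1).
Proof.
elim: n y => [|n1 _ n2 IH] y ry sy; first exact: ex_done.
have {}IH := IH (fun j => y j.+1) (fun j => ry j.+1) (fun j => sy j.+1).
have [_ r0] := ry 0 isT.
eapply ex_le.
  apply: ex_loop IH => //.
  apply: (@ex_seq _ _ _ [:: i; word n1 ++ word n2 ++ word (y 0) ++ m; a; a'; [::]]).
    by apply: ex_act; rewrite /do_ops /mkseq /= map_cat -!catA.
  exact: ex_seq (Drop_spec _ _ _ _ _) (ex_seq (Take_spec true false _ _ _ _ _)
    (ex_seq (r0 _ _ _ _) (BackA_spec _ _ _ _ _))).
have := leq_pow e (leq_add (sy 0 isT) (leqnn 2)); rewrite tsize_node /=.
move: ((_ + 2) ^ e) ((b + 2) ^ e) => p q.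
by nia.
Qed.

Lemma run_iter c e d : exists f, forall n (y : nat -> tree),
  (forall j, j < spine n -> run c e (y j) (y j.+1)) ->
  (forall j, j <= spine n -> tsize (y j) <= (tsize (Node n (y 0)) + 2) ^ d) ->
  run (IterP c) f (Node n (y 0)) (y (spine n)).
Proof.
have [f bf] : pbound (fun n => (n + 2) ^ d +
  n * (9 * n + 20 + ((n + 2) ^ d + 2) ^ e) + 10) by pbound.
exists f => n y ry sy; split.
  by apply: leq_trans (bf _); have := sy _ (leqnn _); lia.
move=> i m a b; apply: (ex_le _ (bf _)).
have := iter_loop_spec i m a b ry sy; set t := Node n (y 0) => h.
eapply ex_le.
  apply: (@ex_seq _ _ _ [:: i; word n ++ word (y 0) ++ m; a; b; [::]]).
    by apply: ex_act; rewrite /do_ops /mkseq /= map_cat -catA.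
  apply: ex_seq h _; exact: ex_act.
have : spine n <= tsize t by have := spine_le n; rewrite /t tsize_node; lia.
have : tsize n <= tsize t by rewrite /t tsize_node; lia.
move: (_ ^ e) => q; move: (_ ^ d) => p.
by nia.
Qed.


(** * Polynomial-time functions on encoded data *)

(* Canonical structures select the encoding of a type; the encoding need not be
   injective, as the decoding is never used. *)
Structure encType := EncType { enc_sort :> Type; code : enc_sort -> tree }.

Canonical pair_encType (A B : encType) :=
  EncType (fun p : A * B => Node (code p.1) (code p.2)).
Canonical seq_encType (A : encType) :=
  EncType (foldr (fun (a : A) t => Node (code a) t) Leaf).
Canonical option_encType (A : encType) :=
  EncType (fun o : option A => if o is Some a then Node (code a) Leaf else Leaf).
Canonical unit_encType := EncType (fun _ : unit => Leaf).
Canonical bool_encType :=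
  EncType (fun b : bool => if b then Node Leaf Leaf else Leaf).
Canonical nat_encType := EncType (fun n : nat => code (nat_bits n)).

Definition esize (T : encType) (x : T) : nat := tsize (code x).

Definition pt (X Y : encType) (f : X -> Y) : Prop :=
  exists c e, forall x, run c e (code x) (code (f x)).

Lemma esize_pair (A B : encType) (a : A) (b : B) :
  esize (a, b) = (esize a + esize b).+1.
Proof. exact: tsize_node. Qed.

Lemma esize_cons (A : encType) (a : A) s :
  esize (a :: s) = (esize a + esize s).+1.
Proof. exact: tsize_node. Qed.

Lemma esize_nil (A : encType) : esize ([::] : seq A) = 1.
Proof. by []. Qed.

Lemma esize_some (A : encType) (a : A) : esize (Some a) = (esize a).+2.
Proof. by rewrite /esize [code _]/= tsize_node addn1. Qed.

Lemma esize_gt0 (A : encType) (a : A) : 0 < esize a.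
Proof. exact: tsize_gt0. Qed.

Lemma esize_bool (b : bool) : esize b <= 3.
Proof. by case: b. Qed.

Lemma esize_cat (A : encType) (s t : seq A) :
  (esize (s ++ t)).+1 = esize s + esize t.
Proof.
elim: s => [|a s IH]; first by rewrite esize_nil add1n.
by rewrite cat_cons !esize_cons; lia.
Qed.

Lemma size_esize (A : encType) (s : seq A) : size s < esize s.
Proof. by elim: s => // a s IH; rewrite esize_cons /=; lia. Qed.

Lemma esize_drop (A : encType) k (s : seq A) : esize (drop k s) <= esize s.
Proof.
by elim: s k => [|a s IH] [|k] //; rewrite drop_cons esize_cons; have := IH k; lia.
Qed.

Lemma esize_nseq n : esize (nseq n tt) = n.*2.+1.
Proof. by elim: n => // n IH; rewrite [nseq _ _]/= esize_cons IH doubleS. Qed.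

Lemma spine_code (A : encType) (s : seq A) : spine (code s) = size s.
Proof. by elim: s => //= a s ->. Qed.

(** * Closure under composition, constructors and case distinction *)

Lemma pt_bound (X Y : encType) (f : X -> Y) :
  pt f -> exists e, forall x, esize (f x) <= (esize x + 2) ^ e.
Proof. by move=> [c [e h]]; exists e => x; case: (h x). Qed.

(** Only codes matter, so a change of type that keeps the code is free: a nonempty list is a pair,
    an option is a list of length at most one, a Boolean is an option of [unit], a number is its
    list of digits. *)
Lemma pt_code (X Y Z : encType)
  (f : X -> Y) (g : X -> Z) :
  (forall x, code (g x) = code (f x)) -> pt f -> pt g.
Proof. by move=> fg [c [e h]]; exists c, e => x; rewrite fg. Qed.

Lemma pt_ext (X Y : encType) (f g : X -> Y) :
  f =1 g -> pt f -> pt g.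
Proof. by move=> fg; apply: pt_code => x; rewrite fg. Qed.

Lemma pt_id (X : encType) : pt (fun x : X => x).
Proof. by have [e h] := run_id; exists SkipP, e. Qed.

Lemma pt_const (X Y : encType) (y : Y) :
  pt (fun _ : X => y).
Proof. by have [e h] := run_const (code y); exists (ConstP (code y)), e. Qed.

Lemma pt_comp (X Y Z : encType)
  (g : Y -> Z) (f : X -> Y) : pt g -> pt f -> pt (fun x => g (f x)).
Proof.
move=> [c2 [e2 h2]] [c1 [e1 h1]]; have [e h] := run_comp c1 c2 e1 e2.
by exists (Seq c1 c2), e => x; apply: h (h1 x) (h2 _).
Qed.

Lemma pt_pair (X A B : encType)
  (f : X -> A) (g : X -> B) : pt f -> pt g -> pt (fun x => (f x, g x)).
Proof.
move=> [c1 [e1 h1]] [c2 [e2 h2]]; have [e h] := run_pair c1 c2 e1 e2.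
by exists (PairP c1 c2), e => x; apply: h (h1 x) (h2 x).
Qed.

Lemma pt_fst (X A B : encType)
  (f : X -> A * B) : pt f -> pt (fun x => (f x).1).
Proof.
apply: (pt_comp (g := fst)); have [e h] := run_fst.
by exists FstP, e => -[a b]; apply: h.
Qed.

Lemma pt_snd (X A B : encType)
  (f : X -> A * B) : pt f -> pt (fun x => (f x).2).
Proof.
apply: (pt_comp (g := snd)); have [e h] := run_snd.
by exists SndP, e => -[a b]; apply: h.
Qed.

Lemma pt_cons (X A : encType) (f : X -> A) (g : X -> seq A) :
  pt f -> pt g -> pt (fun x => f x :: g x).
Proof. by move=> hf hg; apply: pt_code (pt_pair hf hg). Qed.

Lemma pt_some (X A : encType) (f : X -> A) :
  pt f -> pt (fun x => Some (f x)).
Proof.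
by move=> hf; apply: pt_code (pt_pair hf (pt_const _ ([::] : seq unit))).
Qed.

Lemma pt_list (X A Y : encType)
  (l : X -> seq A) (f : X -> Y) (g : X -> A -> seq A -> Y) :
  pt l -> pt f -> pt (fun p : X * (A * seq A) => g p.1 p.2.1 p.2.2) ->
  pt (fun x => if l x is a :: s then g x a s else f x).
Proof.
move=> [c [e h]] [c1 [e1 h1]] [c2 [e2 h2]].
(* In the nonempty case [l x] is computed once more next to a copy of [x]; its code is that of the
   pair of head and tail. *)
have [ei hi] := run_id; have [ep hp] := run_pair SkipP c ei e.
have [e2' h2'] := run_comp (PairP SkipP c) c2 ep e2.
have [e' h'] := run_case c c1 (Seq (PairP SkipP c) c2) e e1 e2'.
exists (CaseP c c1 (Seq (PairP SkipP c) c2)), e' => x.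
apply: h' (h x) _; have := h x; case: (l x) => [|a s] /= hx //.
by apply: h2' (h2 (x, (a, s))); apply: hp.
Qed.

Lemma pt_option (X A Y : encType)
  (o : X -> option A) (f : X -> Y) (g : X -> A -> Y) :
  pt o -> pt f -> pt (fun p : X * A => g p.1 p.2) ->
  pt (fun x => if o x is Some a then g x a else f x).
Proof.
move=> ho hf hg.
have hl : pt (fun x => if o x is Some a then [:: a] else [::]).
  by apply: pt_code ho => x; case: (o x).
apply: pt_ext (pt_list (g := fun x a _ => g x a) hl hf _).
  by move=> x /=; case: (o x).
by apply: (pt_comp (f := fun p => (p.1, p.2.1)) hg);
   apply: pt_pair; repeat first [apply: pt_id|apply: pt_fst|apply: pt_snd].
Qed.

Lemma pt_if (X Y : encType) (b : X -> bool) (f g : X -> Y) :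
  pt b -> pt f -> pt g -> pt (fun x => if b x then f x else g x).
Proof.
move=> hb hf hg.
have ho : pt (fun x => if b x then Some tt else None).
  by apply: pt_code hb => x; case: (b x).
apply: pt_ext (pt_option (g := fun x _ => f x) ho hg _).
  by move=> x /=; case: (b x).
by apply: pt_comp hf _; apply/pt_fst/pt_id.
Qed.

(** * Folding along lists *)

Lemma pt_foldl (X A B : encType)
  (h : X -> B -> A -> B) (z : X -> B) (l : X -> seq A) :
  pt (fun p : X * (B * A) => h p.1 p.2.1 p.2.2) -> pt z -> pt l ->
  (exists d, forall x k, esize (foldl (h x) (z x) (take k (l x))) <= (esize x + 2) ^ d) ->
  pt (fun x => foldl (h x) (z x) (l x)).
Proof.
move=> hh hz hl [d hd].
(* One round of the loop: the parameter [x] is carried along and the next item is absorbed into the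
   accumulator. *)
have ptF : pt (fun p : X * (seq A * B) => if p.2.1 is a :: s
    then (p.1, (s, h p.1 p.2.2 a)) else p).
  apply: (pt_list (g := fun p a s => (p.1, (s, h p.1 p.2.2 a)))).
  - by apply/pt_fst/pt_snd/pt_id.
  - exact: pt_id.
  - apply: pt_pair; first by apply/pt_fst/pt_fst/pt_id.
    apply: pt_pair; first by apply/pt_snd/pt_snd/pt_id.
    apply: (pt_comp (f := fun p => (p.1.1, (p.1.2.2, p.2.1))) hh).
    by do 2?[apply: pt_pair]; repeat first [apply: pt_id|apply: pt_fst|apply: pt_snd].
have [c [e hF]] := ptF; have [el bl] := pt_bound hl.
have [d' bd] : pbound (fun n => n + (n + 2) ^ el + (n + 2) ^ d + 10) by pbound.
have [f hf] := run_iter c e d'.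
pose y x j := code (x, (drop j (l x), foldl (h x) (z x) (take j (l x)))).
have pt_it : pt (fun x => (x, ([::] : seq A, foldl (h x) (z x) (l x)))).
  (* The first copy of [l x] is the loop counter, the second one supplies the items. *)
  have [c1 [e1 h1]] : pt (fun x => (l x, (x, (l x, z x)))).
    by do !apply: pt_pair => //; apply: pt_id.
  have [e2 h2] := run_comp c1 (IterP c) e1 f.
  exists (Seq c1 (IterP c)), e2 => x; apply: (h2 _ _ _ (h1 x)).
  have := hf (code (l x)) (y x); rewrite spine_code /y drop0 take0 drop_size take_size.
  apply=> j.
    move=> lt_j; have := hF (x, (drop j (l x), foldl (h x) (z x) (take j (l x)))).
    (* [A] may be empty, but [j < size (l x)] provides an element to serve as the default of
       [nth]. *)
    have [a l0] : exists a : A, True by case: (l x) lt_j => // a; exists a.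
    by rewrite (drop_nth a lt_j) (take_nth a lt_j) foldl_rcons.
  move=> le_j; rewrite tsize_node -!/(esize _) !esize_pair.
  have := hd x j; have := bl x; have := esize_drop j (l x).
  have := bd (esize x) => b1 b2 b3 b4.
  apply: (@leq_trans ((esize x + 2) ^ d')); first by lia.
  apply: leq_pow; lia.
exact: pt_ext (pt_snd (pt_snd pt_it)).
Qed.

(** If a step adds an amount bounded in terms of [x] and the item, independently of the accumulator,
    then the total growth is at most the length of the list times a polynomial. *)
Lemma pt_foldl_add (X A B : encType)
  (h : X -> B -> A -> B) (z : X -> B) (l : X -> seq A) :
  pt (fun p : X * (B * A) => h p.1 p.2.1 p.2.2) -> pt z -> pt l ->
  (exists d, forall x b a, esize (h x b a) <= esize b + (esize x + esize a + 2) ^ d) ->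
  pt (fun x => foldl (h x) (z x) (l x)).
Proof.
move=> hh hz hl [d hd]; apply: pt_foldl => //.
have [el bl] := pt_bound hl; have [ez bz] := pt_bound hz.
have [d' bd] : pbound (fun n => (n + 2) ^ ez +
  (n + 2) ^ el * (n + (n + 2) ^ el + 2) ^ d) by pbound.
exists d' => x k; apply: leq_trans (bd _).
have le_s : esize (take k (l x)) <= (esize x + 2) ^ el.
  apply: leq_trans (bl x); have := esize_cat (take k (l x)) (drop k (l x)).
  by rewrite cat_take_drop; have := esize_gt0 (drop k (l x)); lia.
have sz := size_esize (take k (l x)).
apply: (@leq_trans (esize (z x) +
  size (take k (l x)) * (esize x + (esize x + 2) ^ el + 2) ^ d)); last first.
  apply: leq_add => //; apply: leq_mul => //; lia.
move: (take k (l x)) le_s {sz} (z x) => s le_s b; elim: s b le_s => [|a s IH] b le_s.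
  by rewrite /= addn0.
rewrite /= mulSn; move: le_s; rewrite esize_cons => le_s.
have := IH (h x b a); have := hd x b a.
have : (esize x + esize a + 2) ^ d <= (esize x + (esize x + 2) ^ el + 2) ^ d.
  by apply: leq_pow; lia.
by lia.
Qed.

Ltac pt_proj := solve [repeat first
  [ assumption | apply: pt_id | apply: pt_fst | apply: pt_snd | apply: pt_const
  | apply: pt_pair]].

Lemma pt_rev (X A : encType) (l : X -> seq A) :
  pt l -> pt (fun x => rev (l x)).
Proof.
move=> hl; apply: (@pt_ext _ _ (fun x => foldl (fun s a => a :: s) [::] (l x))).
  by move=> x; rewrite -[l x]revK foldl_rev revK; elim: (rev (l x)) => //= a s ->.
apply: (pt_foldl_add (h := fun (x : X) s a => a :: s)) => //.
- by apply: pt_cons; pt_proj.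
- exact: pt_const.
- by exists 1 => x b a; rewrite esize_cons; lia.
Qed.

Lemma pt_foldr (X A B : encType)
  (h : X -> A -> B -> B) (z : X -> B) (l : X -> seq A) :
  pt (fun p : X * (A * B) => h p.1 p.2.1 p.2.2) -> pt z -> pt l ->
  (exists d, forall x b a, esize (h x a b) <= esize b + (esize x + esize a + 2) ^ d) ->
  pt (fun x => foldr (h x) (z x) (l x)).
Proof.
move=> hh hz hl hd.
apply: (@pt_ext _ _ (fun x => foldl (fun b a => h x a b) (z x) (rev (l x)))).
  by move=> x; rewrite foldl_rev.
apply: (pt_foldl_add (h := fun x b a => h x a b)) => //; last exact: pt_rev.
by apply: (pt_comp (f := fun p => (p.1, (p.2.2, p.2.1))) hh); pt_proj.
Qed.

Lemma pt_map (X A B : encType)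
  (g : X -> A -> B) (l : X -> seq A) :
  pt (fun p : X * A => g p.1 p.2) -> pt l -> pt (fun x => map (g x) (l x)).
Proof.
move=> hg hl; apply: (@pt_ext _ _ (fun x => foldr (fun a s => g x a :: s) [::] (l x))).
  by move=> x.
apply: (pt_foldr (h := fun x a s => g x a :: s)) => //.
- by apply: pt_cons; [apply: (pt_comp (f := fun p => (p.1, p.2.1)) hg)|]; pt_proj.
- exact: pt_const.
- have [e he] := pt_bound hg.
  have [d bd] : pbound (fun n => (n + 1 + 2) ^ e + 1) by pbound.
  exists d => x b a; rewrite esize_cons; have := he (x, a); rewrite esize_pair /=.
  by have := bd (esize x + esize a); rewrite addn1; lia.
Qed.

Lemma pt_filter (X A : encType)
  (g : X -> A -> bool) (l : X -> seq A) :
  pt (fun p : X * A => g p.1 p.2) -> pt l -> pt (fun x => filter (g x) (l x)).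
Proof.
move=> hg hl; apply: (@pt_ext _ _
  (fun x => foldr (fun a s => if g x a then a :: s else s) [::] (l x))).
  by move=> x.
apply: (pt_foldr (h := fun x a s => if g x a then a :: s else s)) => //.
- apply: pt_if; first by apply: (pt_comp (f := fun p => (p.1, p.2.1)) hg); pt_proj.
    by apply: pt_cons; pt_proj.
  by pt_proj.
- exact: pt_const.
- by exists 1 => x b a; case: (g x a); rewrite ?esize_cons; lia.
Qed.

Lemma pt_pmap (X A B : encType)
  (g : X -> A -> option B) (l : X -> seq A) :
  pt (fun p : X * A => g p.1 p.2) -> pt l -> pt (fun x => pmap (g x) (l x)).
Proof.
move=> hg hl; apply: (@pt_ext _ _
  (fun x => foldr (fun a s => if g x a is Some b then b :: s else s) [::] (l x))).
  by move=> x; elim: (l x) => //= a s ->; case: (g x a).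
apply: (pt_foldr (h := fun x a s => if g x a is Some b then b :: s else s)) => //.
- apply: (pt_option (g := fun p b => b :: p.2.2)).
  + by apply: (pt_comp (f := fun p => (p.1, p.2.1)) hg); pt_proj.
  + by pt_proj.
  + by apply: pt_cons; pt_proj.
- exact: pt_const.
- have [e he] := pt_bound hg.
  have [d bd] : pbound (fun n => (n + 1 + 2) ^ e + 1) by pbound.
  exists d => x b a; have := he (x, a); rewrite esize_pair /=.
  have := bd (esize x + esize a); rewrite addn1.
  by case: (g x a) => [c|]; rewrite ?esize_cons ?esize_some; lia.
Qed.

Lemma pt_cat (X A : encType) (f g : X -> seq A) :
  pt f -> pt g -> pt (fun x => f x ++ g x).
Proof.
move=> hf hg; apply: (@pt_ext _ _ (fun x => foldr cons (g x) (f x))).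
  by move=> x; elim: (f x) => //= a s ->.
apply: (pt_foldr (h := fun (x : X) => cons)) => //; first by apply: pt_cons; pt_proj.
by exists 1 => x b a; rewrite esize_cons; lia.
Qed.

Lemma pt_rcons (X A : encType) (s : X -> seq A) (a : X -> A) :
  pt s -> pt a -> pt (fun x => rcons (s x) (a x)).
Proof.
move=> hs ha; apply: (@pt_ext _ _ (fun x => s x ++ [:: a x])).
  by move=> x; rewrite cats1.
by apply: pt_cat => //; apply: pt_cons => //; apply: pt_const.
Qed.

Lemma pt_omap_pair (X A : encType) (i : X -> nat) (o : X -> option A) :
  pt i -> pt o -> pt (fun x => omap (pair (i x)) (o x)).
Proof.
move=> hi ho.
apply: (@pt_ext _ _ (fun x => if o x is Some a then Some (i x, a) else None)).
  by move=> x; case: (o x).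
apply: (pt_option (g := fun x a => Some (i x, a))) => //; first exact: pt_const.
by apply/pt_some/pt_pair; [apply: (pt_comp hi)|]; pt_proj.
Qed.

Lemma pt_negb (X : encType) (f : X -> bool) : pt f -> pt (fun x => ~~ f x).
Proof. by move=> hf; apply: pt_if => //; apply: pt_const. Qed.

Lemma pt_andb (X : encType) (f g : X -> bool) :
  pt f -> pt g -> pt (fun x => f x && g x).
Proof. by move=> hf hg; apply: pt_if => //; apply: pt_const. Qed.

Lemma pt_orb (X : encType) (f g : X -> bool) :
  pt f -> pt g -> pt (fun x => f x || g x).
Proof. by move=> hf hg; apply: pt_if => //; apply: pt_const. Qed.

Lemma pt_implyb (X : encType) (f g : X -> bool) :
  pt f -> pt g -> pt (fun x => f x ==> g x).
Proof. by move=> hf hg; apply: pt_if => //; apply: pt_const. Qed.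

Lemma pt_eqb (X : encType) (f g : X -> bool) :
  pt f -> pt g -> pt (fun x => f x == g x).
Proof.
move=> hf hg; apply: (@pt_ext _ _ (fun x => if f x then g x else ~~ g x)).
  by move=> x; case: (f x); case: (g x).
by apply: pt_if => //; apply: pt_negb.
Qed.

Lemma pt_all (X A : encType)
  (g : X -> A -> bool) (l : X -> seq A) :
  pt (fun p : X * A => g p.1 p.2) -> pt l -> pt (fun x => all (g x) (l x)).
Proof.
move=> hg hl; apply: (@pt_ext _ _ (fun x => foldr (fun a b => g x a && b) true (l x))).
  by move=> x.
apply: (pt_foldr (h := fun x a b => g x a && b)) => //.
- apply: pt_andb; last by pt_proj.
  by apply: (pt_comp (f := fun p => (p.1, p.2.1)) hg); pt_proj.
- exact: pt_const.
- exists 2 => x b a; apply: leq_trans (esize_bool _) _.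
  by have := esize_gt0 x; have := esize_gt0 a; nia.
Qed.

Lemma pt_has (X A : encType)
  (g : X -> A -> bool) (l : X -> seq A) :
  pt (fun p : X * A => g p.1 p.2) -> pt l -> pt (fun x => has (g x) (l x)).
Proof.
move=> hg hl; apply: (@pt_ext _ _ (fun x => ~~ all (fun a => ~~ g x a) (l x))).
  by move=> x; rewrite -(has_predC); apply: eq_has => a /=; rewrite negbK.
by apply/pt_negb/(pt_all (g := fun x a => ~~ g x a)) => //; apply: pt_negb.
Qed.

Lemma pt_nilp (X A : encType) (l : X -> seq A) :
  pt l -> pt (fun x => nilp (l x)).
Proof.
move=> hl; apply: (@pt_ext _ _ (fun x => if l x is a :: s then false else true)).
  by move=> x; case: (l x).
by apply: (pt_list (g := fun _ _ _ => false)) => //; apply: pt_const.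
Qed.

Lemma pt_behead (X A : encType) (l : X -> seq A) :
  pt l -> pt (fun x => behead (l x)).
Proof.
move=> hl; apply: (@pt_ext _ _ (fun x => if l x is a :: s then s else [::])).
  by move=> x; case: (l x).
by apply: (pt_list (g := fun _ _ s => s)) => //; pt_proj.
Qed.

Lemma pt_isSome (X A : encType) (o : X -> option A) :
  pt o -> pt (fun x => isSome (o x)).
Proof.
move=> ho; apply: (@pt_ext _ _ (fun x => if o x is Some a then true else false)).
  by move=> x; case: (o x).
by apply: (pt_option (g := fun _ _ => true)) => //; pt_proj.
Qed.

(** * Unary and binary numbers *)

(** Unary output, suited to counts and scores, which are bounded by lengths of lists in the input:
    arithmetic becomes list manipulation. For [f] into [nat], [pt] refers to binary output. *)
Definition ptn (X : encType) (f : X -> nat) : Prop :=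
  pt (fun x => nseq (f x) tt).

Lemma ptn_ext (X : encType) (f g : X -> nat) : f =1 g -> ptn f -> ptn g.
Proof. by move=> fg; apply: pt_ext => x; rewrite fg. Qed.

Lemma ptn_const (X : encType) n : ptn (fun _ : X => n).
Proof. exact: pt_const. Qed.

Lemma ptn_size (X A : encType) (l : X -> seq A) :
  pt l -> ptn (fun x => size (l x)).
Proof.
move=> hl; apply: (@pt_ext _ _ (fun x => map (fun=> tt) (l x))).
  by move=> x; elim: (l x) => //= a s ->.
by apply: (pt_map (g := fun _ _ => tt)) => //; apply: pt_const.
Qed.

Lemma ptn_count (X A : encType)
  (g : X -> A -> bool) (l : X -> seq A) :
  pt (fun p : X * A => g p.1 p.2) -> pt l -> ptn (fun x => count (g x) (l x)).
Proof.
move=> hg hl; apply: (ptn_ext (f := fun x => size (filter (g x) (l x)))).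
  by move=> x; rewrite size_filter.
by apply/ptn_size/pt_filter.
Qed.

Lemma ptn_comp (X Y : encType) (g : Y -> nat) (f : X -> Y) :
  ptn g -> pt f -> ptn (fun x => g (f x)).
Proof. exact: pt_comp. Qed.

Lemma ptn_nat_of_bool (X : encType) (b : X -> bool) :
  pt b -> ptn (fun x => nat_of_bool (b x)).
Proof.
move=> hb; apply: pt_ext (pt_if hb (pt_const _ [:: tt]) (pt_const _ [::])) => x.
by case: (b x).
Qed.

Lemma ptn_add (X : encType) (f g : X -> nat) :
  ptn f -> ptn g -> ptn (fun x => f x + g x).
Proof.
by move=> hf hg; apply: pt_ext (pt_cat hf hg) => x; rewrite nseqD.
Qed.

Lemma ptn_succ (X : encType) (n : X -> nat) : ptn n -> ptn (fun x => (n x).+1).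
Proof. by move=> hn; apply: pt_cons (pt_const _ tt) hn. Qed.

Lemma esize_behead (A : encType) (s : seq A) : esize (behead s) <= esize s.
Proof. by case: s => //= a s; rewrite esize_cons; lia. Qed.

Lemma pt_drop (X A : encType) (n : X -> nat) (l : X -> seq A) :
  ptn n -> pt l -> pt (fun x => drop (n x) (l x)).
Proof.
move=> hn hl; apply: (@pt_ext _ _
  (fun x => foldl (fun s _ => behead s) (l x) (nseq (n x) tt))).
  by move=> x; elim: (n x) (l x) => [|m IH] [|a s] //=; rewrite IH.
apply: (pt_foldl_add (h := fun (_ : X) s (_ : unit) => behead s)) => //.
  by apply: pt_behead; pt_proj.
by exists 0 => x b a; apply: leq_trans (esize_behead b) _; lia.
Qed.

Lemma pt_take (X A : encType) (n : X -> nat) (l : X -> seq A) :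
  ptn n -> pt l -> pt (fun x => take (n x) (l x)).
Proof.
move=> hn hl.
have hs : ptn (fun x => size (l x) - n x).
  apply: (ptn_ext (f := fun x => size (drop (n x) (l x)))).
    by move=> x; rewrite size_drop.
  by apply: ptn_size; apply: pt_drop.
apply: pt_ext (pt_rev (pt_drop hs (pt_rev hl))) => x.
rewrite drop_rev revK; case: (leqP (n x) (size (l x))) => [le_n|/ltnW le_n].
  by rewrite subKn.
by rewrite (eqP le_n) subn0 take_size take_oversize.
Qed.

Lemma ptn_sub (X : encType) (f g : X -> nat) :
  ptn f -> ptn g -> ptn (fun x => f x - g x).
Proof. by move=> hf hg; apply: pt_ext (pt_drop hg hf) => x; rewrite drop_nseq. Qed.

Lemma pt_leq (X : encType) (f g : X -> nat) :
  ptn f -> ptn g -> pt (fun x => f x <= g x).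
Proof.
move=> hf hg; apply: pt_ext (pt_nilp (ptn_sub hf hg)) => x.
by rewrite /nilp size_nseq.
Qed.

Lemma pt_eqn (X : encType) (f g : X -> nat) :
  ptn f -> ptn g -> pt (fun x => f x == g x).
Proof.
move=> hf hg; apply: (@pt_ext _ _ (fun x => (f x <= g x) && (g x <= f x))).
  by move=> x; rewrite eqn_leq.
by apply: pt_andb; apply: pt_leq.
Qed.

Lemma ptn_find (X A : encType)
  (g : X -> A -> bool) (l : X -> seq A) :
  pt (fun p : X * A => g p.1 p.2) -> pt l -> ptn (fun x => find (g x) (l x)).
Proof.
move=> hg hl; apply: (@pt_ext _ _
  (fun x => foldr (fun a s => if g x a then [::] else tt :: s) [::] (l x))).
  by move=> x; elim: (l x) => //= a s ->; case: (g x a).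
apply: (pt_foldr (h := fun x a s => if g x a then [::] else tt :: s)) => //.
- apply: pt_if; first by apply: (pt_comp (f := fun p => (p.1, p.2.1)) hg); pt_proj.
    exact: pt_const.
  by apply: pt_cons; pt_proj.
- exact: pt_const.
- exists 1 => x b a; case: (g x a); rewrite ?esize_cons ?esize_nil.
    by have := esize_gt0 b; lia.
  by have := esize_gt0 a; have -> : esize tt = 1 by []; lia.
Qed.

Lemma pt_eq_bits (X : encType) (f g : X -> seq bool) :
  pt f -> pt g -> pt (fun x => f x == g x).
Proof.
move=> hf hg.
(* The state tells whether the digits agree so far and what is left of the second list; the final
   [nilp] excludes a longer second list. *)
pose h (x : X) (p : bool * seq bool) (a : bool) :=
  if p.2 is b :: s then (p.1 && (a == b), s) else (false, [::] : seq bool).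
apply: (@pt_ext _ _ (fun x => let r := foldl (h x) (true, g x) (f x) in
  r.1 && nilp r.2)).
  move=> x; rewrite -[RHS]andTb; elim: (f x) (g x) true => [|a s IH] [|b t] //= c.
  - by rewrite !andbF; elim: s {IH}.
  - by rewrite IH eqseq_cons andbA.
have hr : pt (fun x => foldl (h x) (true, g x) (f x)).
  apply: pt_foldl_add => //.
  - rewrite /h /=; apply: (pt_list (g := fun (p : X * (bool * seq bool * bool)) b s =>
      (p.2.1.1 && (p.2.2 == b), s))).
    + by pt_proj.
    + exact: pt_const.
    + apply: pt_pair; last by pt_proj.
      by apply: pt_andb; [pt_proj|apply: pt_eqb; pt_proj].
  - by apply: pt_pair => //; apply: pt_const.
  - exists 2 => x [c s] a; rewrite /h; case: s => [|b s];
      rewrite [X in esize X <= _]/= !esize_pair ?esize_cons ?esize_nil -mulnn.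
      by have := esize_bool false; have := esize_gt0 x; nia.
    by have := esize_bool (c && (a == b)); have := esize_gt0 x; nia.
by apply: pt_andb; [apply: pt_fst|apply/pt_nilp/pt_snd].
Qed.

(** * Binary numerals *)

Definition bits_nat (s : seq bool) : nat := foldr (fun (b : bool) n => b + n.*2) 0 s.

Lemma nat_bitsK : cancel nat_bits bits_nat.
Proof.
move=> n; rewrite /nat_bits -[RHS]bin_of_natK; case: bin_of_nat => //= p.
by elim: p => //= p ->; rewrite ?NatTrec.doubleE.
Qed.

(** This property characterizes the canonical numerals: there is no leading zero, and the default
    [true] admits the empty numeral of 0. *)
Lemma last_nat_bits n : last true (nat_bits n).
Proof.
rewrite /nat_bits; case: bin_of_nat => //= p.
suff h : forall b, last b (pos_bits p) = true by rewrite h.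
by elim: p => //=.
Qed.

Lemma bits_nat_cons b s : bits_nat (b :: s) = b + (bits_nat s).*2.
Proof. by []. Qed.

Lemma bits_nat_gt0 s : last false s -> 0 < bits_nat s.
Proof.
elim: s => // b s IH; rewrite bits_nat_cons; case: s IH => [|c s] IH; first by case: b.
by move=> /IH; move: (bits_nat _) => n; lia.
Qed.

(** Parity determines the lowest digit and halving the others; a nonempty numeral without leading
    zero is positive, which separates it from the empty one. *)
Lemma bits_nat_inj s t : last true s -> last true t -> bits_nat s = bits_nat t -> s = t.
Proof.
have pos b u : last true (b :: u) -> 0 < bits_nat (b :: u) by apply: (@bits_nat_gt0 (b :: u)).
elim: s t => [|b s IH] [|c t] // hs ht.
- by move=> e; have := pos _ _ ht; rewrite -e.
- by move=> e; have := pos _ _ hs; rewrite e.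
rewrite !bits_nat_cons => e.
have half d n : odd (nat_of_bool d + n.*2) = d /\ (d + n.*2)./2 = n.
  by rewrite half_bit_double oddD odd_double addbF; case: d.
have [[o1 h1] [o2 h2]] := (half b (bits_nat s), half c (bits_nat t)).
rewrite -o1 e o2; congr (_ :: _); apply: IH; last by rewrite -h1 e h2.
- by case: s hs {e o1 h1}.
- by case: t ht {e o2 h2}.
Qed.

Lemma bits_natK s : last true s -> nat_bits (bits_nat s) = s.
Proof.
by move=> h; apply: bits_nat_inj => //; rewrite ?nat_bitsK //; apply: last_nat_bits.
Qed.

Lemma pt_nat_bits (X : encType) (f : X -> nat) :
  pt f -> pt (fun x => nat_bits (f x)).
Proof. exact: pt_code. Qed.

Lemma pt_eq (X : encType) (f g : X -> nat) :
  pt f -> pt g -> pt (fun x => f x == g x).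
Proof.
move=> hf hg; apply: pt_ext (pt_eq_bits (pt_nat_bits hf) (pt_nat_bits hg)) => x.
by rewrite (can_eq nat_bitsK).
Qed.

Lemma pt_mem (X : encType) (f : X -> nat) (l : X -> seq nat) :
  pt f -> pt l -> pt (fun x => f x \in l x).
Proof.
move=> hf hl; apply: (@pt_ext _ _ (fun x => has (fun y => y == f x) (l x))).
  by move=> x; rewrite has_pred1.
apply: (pt_has (g := fun x (y : nat) => y == f x)) => //.
by apply: pt_eq; [pt_proj|apply: pt_comp hf _; pt_proj].
Qed.

(* A binary number may be exponentially large; it is read from its most
   significant digit on and cut off at the unary number it is compared with. *)
Lemma pt_leq_nat (X : encType) (f g : X -> nat) :
  ptn f -> pt g -> pt (fun x => f x <= g x).
Proof.
move=> hf hg.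
pose h x (b : bool) n := minn (b + n.*2) (f x).
(* Cutting off after each digit agrees with cutting off once at the end, since a value that has
   reached [f x] stays at least [f x] under doubling. *)
have hcut x s : foldr (h x) 0 s = minn (bits_nat s) (f x).
  elim: s => [|b s IH]; first by rewrite min0n.
  by rewrite /= IH /h -/(bits_nat s); lia.
have : ptn (fun x => foldr (h x) 0 (nat_bits (g x))).
  (* The unary form of [h]: [u ++ u] doubles, and dropping as many items as [v] has beyond [f x]
     leaves the minimum of the two lengths. *)
  pose h' x (b : bool) (u : seq unit) := 
    let v := nseq b tt ++ (u ++ u) in drop (size (drop (f x) v)) v.
  apply: (@pt_ext _ _ (fun x => foldr (h' x) [::] (nat_bits (g x)))).
    move=> x; elim: (nat_bits (g x)) => //= b s ->; rewrite /h' /h.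
    rewrite -!nseqD !drop_nseq !size_nseq; congr nseq; lia.
  have hh : pt (fun p : X * (seq unit * bool) => h' p.1 p.2.2 p.2.1).
    have hv : pt (fun p : X * (seq unit * bool) => nseq p.2.2 tt ++ (p.2.1 ++ p.2.1)).
      by apply: pt_cat; [apply: ptn_nat_of_bool|apply: pt_cat]; pt_proj.
    apply: pt_drop => //; apply/ptn_size/pt_drop => //.
    by apply: ptn_comp hf _; pt_proj.
  apply: (@pt_ext _ _ (fun x => foldl (fun u b => h' x b u) [::] (rev (nat_bits (g x))))).
    by move=> x; rewrite foldl_rev.
  (* Doubling is not additive growth, so the general fold is used; the cut-off bounds every partial
     result by [f x]. *)
  apply: (pt_foldl (h := fun x u b => h' x b u)) => //.
  - exact: pt_const.
  - by apply/pt_rev/pt_nat_bits.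
  - have [e he] := pt_bound hf; exists e.+1 => x k.
    have := he x; rewrite esize_nseq expnS => le1.
    move: (take _ _) => s; rewrite -[s]revK foldl_rev.
    have -> : foldr (fun b u => h' x b u) [::] (rev s) = nseq (foldr (h x) 0 (rev s)) tt.
      elim: (rev s) => //= b t ->; rewrite /h' /h.
      by rewrite -!nseqD !drop_nseq !size_nseq; congr nseq; lia.
    by rewrite esize_nseq hcut; have := geq_minr (bits_nat (rev s)) (f x); nia.
move=> hm; apply: pt_ext (pt_leq hf hm) => x.
by rewrite hcut nat_bitsK leq_min leqnn andbT.
Qed.


(** * Words as input *)

(** Three Booleans separate the five symbols; the first says whether the symbol is a digit, and in
    that case the second is its value. *)
Definition sym_triple (s : sym) : bool * (bool * bool) :=
  match s with
  | Bit b => (true, (b, b))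
  | Sep => (false, (false, false))
  | Open => (false, (true, false))
  | Close => (false, (false, true))
  end.

Canonical sym_encType := EncType (fun s : sym => code (sym_triple s)).

Definition all_syms : seq sym := [:: Bit true; Bit false; Sep; Open; Close].

Lemma mem_all_syms s : s \in all_syms.
Proof. by case: s => [[]| | |]. Qed.

Lemma esize_sym (s : sym) : esize s <= 11.
Proof. by case: s => [[]| | |]. Qed.

Lemma esize_word (w : seq sym) : esize w <= 12 * size w + 1.
Proof.
elim: w => // s w IH; rewrite esize_cons [size _]/=; have := esize_sym s; lia.
Qed.

(** The code of a list has to be built from the last item on, whereas the input offers its first
    symbol; hence the detour through an auxiliary stack. *)
Definition ReverseInput : cmd letter :=
  While (fun t => isSome (nth None t 0))
    (Act (fun t => [:: Some None; None; copy_op (nth None t 0)])).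

Lemma ReverseInput_spec w m a b :
  ex ReverseInput [:: w; m; a; b; [::]] [:: [::]; m; catrev w a; b; [::]]
     (3 * size w + 1).
Proof.
elim: w a => [|x w IH] a; first by apply: ex_done.
eapply ex_le.
  apply: (ex_loop _ _ (IH (x :: a))) => //; exact: ex_act.
by rewrite /=; lia.
Qed.

Definition push_sym (l : seq sym) : cmd letter :=
  foldr (fun s c => If (fun t => nth None t 2 == Some (inl s : letter))
    (Seq (Pop 2) (push_all (bit true :: word (code s)))) c) SkipP l.

Lemma push_sym_spec l (s : sym) i m a b c : s \in l ->
  ex (push_sym l) [:: i; m; inl s :: a; b; c]
     [:: i; bit true :: word (code s) ++ m; a; b; c] (size l + 30).
Proof.
elim: l => // s' l IH; rewrite inE.
case: (eqVneq s s') => [<- _|ne /= s_l].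
  eapply ex_le.
    apply: (ex_if (b := true)); first exact: eqxx.
    exact: ex_seq (ex_act (erefl _)) (push_all_spec _ _ _ _ _ _).
  have -> : size (bit true :: word (code s)) = (esize s).+1 by rewrite /esize -size_word.
  by have /= := esize_sym s; lia.
eapply ex_le.
  apply: (ex_if (b := false)); last exact: (IH s_l).
  by apply/eqP => -[e]; rewrite e eqxx in ne.
by rewrite /=; lia.
Qed.

Definition PushInput : cmd letter :=
  While (fun t => isSome (nth None t 2)) (push_sym all_syms).

Lemma PushInput_spec (u v : seq sym) i b :
  ex PushInput [:: i; word (code v); map inl u; b; [::]]
     [:: i; word (code (catrev u v)); [::]; b; [::]] (36 * size u + 1).
Proof.
elim: u v => [|s u IH] v; first by apply: ex_done.
have h := push_sym_spec i (word (code v)) (map inl u) b [::] (mem_all_syms s).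
eapply ex_le.
  by apply: (ex_loop _ h); rewrite // -word_node; apply: (IH (s :: v)).
by rewrite [size (_ :: _)]/= (_ : size all_syms = 5) //; lia.
Qed.

Definition InputP : cmd letter := Seq ReverseInput (Seq (Push 1 (bit false)) PushInput).

Lemma InputP_spec (w : seq sym) :
  ex InputP (map inl w :: nseq 4 [::]) [:: [::]; word (code w); [::]; [::]; [::]]
     (40 * size w + 10).
Proof.
have h := PushInput_spec (rev w) [::] [::] [::].
rewrite catrevE revK cats0 map_rev -[rev (map _ _)]cats0 -catrevE in h.
eapply ex_le.
  by apply: ex_seq (ReverseInput_spec _ _ _ _) (ex_seq _ h); apply: ex_act.
by rewrite size_map size_rev; lia.
Qed.

Lemma pt_in_P (f : seq sym -> bool) (L : language sym) :
  pt f -> (forall w, f w <-> L w) -> in_P L.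
Proof.
move=> [c [e h]] fL.
(* Reading the input takes [40 * n + 10] steps, the verdict one more, and the code of the input has
   size at most [12 * n + 1]. *)
have [d bd] : pbound (fun n => 40 * n + 11 + (12 * n + 1 + 2) ^ e) by pbound.
(* The constant comes from [n + 2 <= 3 * n] for positive [n], and from [2 <= 3] for [n = 0]. *)
exists (@machine sym (option bool) 4 (Seq InputP c) is_node), (3 ^ d), d.
suff key (w : seq sym) : exists2 b : bool,
    answer_within (machine 4 (Seq InputP c) is_node) (3 ^ d * size w ^ d + 3 ^ d) w = Some b
    & b <-> L w by exact: key.
exists (f w); last exact: fL.
have [_ /(_ [::] [::] [::] [::])] := h w; rewrite !cats0 => hw.
have [n le_n ex_n] := ex_seq (InputP_spec w) hw.
rewrite (machine_answer is_node ex_n).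
  by rewrite /=; case: (f w).
have le_e : (tsize (code w) + 2) ^ e <= (12 * size w + 1 + 2) ^ e.
  by apply: leq_pow; rewrite leq_add2r; apply: esize_word.
apply: (@leq_trans ((size w + 2) ^ d)); first by have := bd (size w); lia.
case: (size w) => [|m]; first by apply: leq_trans (leq_pow d (isT : 0 + 2 <= 3)) (leq_addl _ _).
by apply: leq_trans (leq_addr _ _); rewrite -expnMn; apply: leq_pow; lia.
Qed.

(** * Parsing *)

Definition parser (A : Type) : Type := seq sym -> option (A * seq sym).

(** As [p] is a function, the equivalence contains soundness, completeness, and the fact that [enc]
    is injective and prefix-free. *)
Definition parses (A : Type) (enc : A -> seq sym) (p : parser A) : Prop :=
  forall s a r, p s = Some (a, r) <-> s = enc a ++ r.

Lemma pt_eq_sym (X : encType) (f : X -> sym) (s : sym) :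
  pt f -> pt (fun x => f x == s).
Proof.
move=> hf; have ht : pt (fun x => sym_triple (f x)) by apply: pt_code hf.
apply: (@pt_ext _ _ (fun x => let t := sym_triple (f x) in let u := sym_triple s in
  (t.1 == u.1) && ((t.2.1 == u.2.1) && (t.2.2 == u.2.2)))).
  by move=> x; case: (f x) => [[]| | |]; case: s => [[]| | |].
by apply: pt_andb; [|apply: pt_andb]; apply: pt_eqb; pt_proj.
Qed.

Definition is_digit (s : sym) : bool := if s is Bit _ then true else false.
Definition digit (s : sym) : bool := if s is Bit b then b else false.

Definition parse_nat : parser nat := fun s =>
  let n := find (fun x => ~~ is_digit x) s in
  let b := map digit (take n s) in
  if drop n s is x :: r then
    if (x == Sep) && last true b then Some (bits_nat b, r) else None
  else None.

Lemma pt_parse_nat : pt parse_nat.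
Proof.
have hd : pt (fun x : sym => ~~ is_digit x).
  apply/pt_negb/(@pt_ext _ _ (fun x => (sym_triple x).1)); first by case.
  by apply: pt_fst; apply: pt_code (pt_id _).
have hv : pt digit.
  apply: (@pt_ext _ _ (fun x => if is_digit x then (sym_triple x).2.1 else false)).
    by case.
  apply: pt_if; last exact: pt_const.
    by apply: pt_ext (pt_negb hd) => x; rewrite negbK.
  by apply/pt_fst/pt_snd; apply: pt_code (pt_id _).
have hn : ptn (fun s : seq sym => find (fun x => ~~ is_digit x) s).
  apply: (ptn_find (g := fun (_ : seq sym) x => ~~ is_digit x) _ (pt_id _)).
  by apply: pt_comp hd _; pt_proj.
have hb : pt (fun s : seq sym => map digit (take (find (fun x => ~~ is_digit x) s) s)).
  apply: (pt_map (g := fun (_ : seq sym) x => digit x)).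
    by apply: pt_comp hv _; pt_proj.
  exact: pt_take hn (pt_id _).
(* The variant returns the digits instead of the number; the codes coincide because a numeral
   passing the test is canonical. *)
pose q s := let n := find (fun x => ~~ is_digit x) s in
  let b := map digit (take n s) in
  if drop n s is x :: r then
    if (x == Sep) && last true b then Some (b, r) else None
  else None.
apply: (pt_code (f := q)).
  move=> s; rewrite /parse_nat /q; case: (drop _ _) => [|x r] //.
  case: ifP => // /andP[_ hl]; rewrite /=.
  by rewrite bits_natK.
rewrite /q; apply: (pt_list (g := fun (s : seq sym) (x : sym) (r : seq sym) =>
  if (x == Sep) && last true (map digit (take (find (fun x => ~~ is_digit x) s) s))
  then Some (map digit (take (find (fun x => ~~ is_digit x) s) s), r) else None)).
- exact: pt_drop hn (pt_id _).
- exact: pt_const.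
- apply: pt_if; last exact: pt_const.
    apply: pt_andb; first by apply: pt_eq_sym; pt_proj.
    apply: (pt_comp (g := last true) (f := fun p => map digit (take
      (find (fun x => ~~ is_digit x) p.1) p.1))); last by apply: pt_comp hb _; pt_proj.
    apply: (@pt_ext _ _ (fun b => if rev b is x :: _ then x else true)).
      by case/lastP => // b x; rewrite rev_rcons last_rcons.
    by apply: (pt_list (g := fun _ x _ => x) (pt_rev (pt_id _))); pt_proj.
  apply/pt_some/pt_pair; last by pt_proj.
  by apply: pt_comp hb _; pt_proj.
Qed.

Lemma parse_natP : parses enc_nat parse_nat.
Proof.
move=> s n r; rewrite /parse_nat /enc_nat cat_rcons; split=> [|->]; last first.
  set d := fun x => ~~ is_digit x; set b := nat_bits n.
  have -> : find d (map Bit b ++ Sep :: r) = size (map Bit b).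
    rewrite find_cat (_ : has d _ = false) /= ?addn0 //.
    by apply/hasPn => _ /mapP[x _ ->].
  rewrite drop_size_cat // take_size_cat // -map_comp map_id last_nat_bits.
  by rewrite nat_bitsK.
set d := fun x => ~~ is_digit x; move=> h.
have all_d : forall u : seq sym, map Bit (map digit (take (find d u) u)) = take (find d u) u.
  by elim=> // x u IH; rewrite /= /d; case: x => [b| | |] //=; rewrite IH.
rewrite -[LHS](cat_take_drop (find d s)); move: h (all_d s).
case: (drop _ _) => [|x t] //; case: ifP => // /andP[/eqP-> hl] [<- <-] e.
by rewrite bits_natK // e.
Qed.

(** Coding a sum as a pair of options turns [getl] and [getr] into projections. *)
Canonical sum_encType (A B : encType) := EncType (fun x : A + B =>
  code (match x with inl a => (Some a, None) | inr b => (None, Some b) end)).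

Definition getl (A B : Type) (x : A + B) : option A := if x is inl a then Some a else None.
Definition getr (A B : Type) (x : A + B) : option B := if x is inr b then Some b else None.

Lemma pt_getl (X A B : encType) (f : X -> A + B) : pt f -> pt (fun x => getl (f x)).
Proof.
move=> hf; apply: (@pt_ext _ _ (fun x => (match f x with
  inl a => (Some a, None) | inr b => (None, Some b) end : option A * option B).1)).
  by move=> x; case: (f x).
by apply: pt_fst; apply: pt_code hf.
Qed.

Lemma pt_getr (X A B : encType) (f : X -> A + B) : pt f -> pt (fun x => getr (f x)).
Proof.
move=> hf; apply: (@pt_ext _ _ (fun x => (match f x with
  inl a => (Some a, None) | inr b => (None, Some b) end : option A * option B).2)).
  by move=> x; case: (f x).
by apply: pt_snd; apply: pt_code hf.
Qed.

Section Combinators.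
Variables (A B : encType) (encA : A -> seq sym) (encB : B -> seq sym).
Variables (p : parser A) (q : parser B).
Hypotheses (ptp : pt (p : seq sym -> option (A * seq sym))) (hp : parses encA p).
Hypotheses (ptq : pt (q : seq sym -> option (B * seq sym))) (hq : parses encB q).

Definition parse_pair : parser (A * B) := fun s =>
  if p s is Some ar then
    if q ar.2 is Some bt then Some ((ar.1, bt.1), bt.2) else None
  else None.

Lemma pt_parse_pair : pt (parse_pair : seq sym -> option (A * B * seq sym)).
Proof.
apply: (pt_option (g := fun (_ : seq sym) (ar : A * seq sym) =>
  if q ar.2 is Some bt then Some ((ar.1, bt.1), bt.2) else None)) => //.
  exact: pt_const.
apply: (pt_option (g := fun (x : seq sym * (A * seq sym)) (bt : B * seq sym) =>
  Some ((x.2.1, bt.1), bt.2))).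
- by apply: pt_comp ptq _; pt_proj.
- exact: pt_const.
- by apply: pt_some; pt_proj.
Qed.

Definition enc_pair (x : A * B) : seq sym := encA x.1 ++ encB x.2.

Lemma parse_pairP : parses enc_pair parse_pair.
Proof.
move=> s [a b] r; rewrite /parse_pair /enc_pair -catA /=; split.
  case ep : (p s) => [[a' t]|] //=; case eq : (q t) => [[b' t']|] //= [<- <- <-].
  by move/hp: ep => ->; move/hq: eq => ->.
by move/hp => -> /=; have /hq-> : encB b ++ r = encB b ++ r by [].
Qed.

Definition enc_sum (x : A + B) : seq sym :=
  match x with inl a => Bit true :: encA a | inr b => Bit false :: encB b end.

Definition parse_sum : parser (A + B) := fun s =>
  if s is x :: r then
    if x == Bit true then
      if p r is Some au then Some (inl au.1, au.2) else None
    else if x == Bit false then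
      if q r is Some bt then Some (inr bt.1, bt.2) else None
    else None
  else None.

Lemma parse_sumP : parses enc_sum parse_sum.
Proof.
move=> [|x s] c r; first by split=> //; case: c.
rewrite /parse_sum /=; case: eqP => [->|ne1].
  split.
    by case e : (p s) => [[a t]|] //= [<- <-]; move/hp: e => ->.
  by case: c => // a [/hp->].
case: eqP => [->|ne2].
  split.
    by case e : (q s) => [[a t]|] //= [<- <-]; move/hq: e => ->.
  by case: c => // a [/hq->].
by split=> //; case: c => a [e _]; rewrite e in ne1 ne2.
Qed.

Lemma pt_parse_sum : pt (parse_sum : seq sym -> option ((A + B) * seq sym)).
Proof.
apply: (pt_list (g := fun (_ : seq sym) (x : sym) (r : seq sym) =>
    if x == Bit true then
      if p r is Some au then Some (inl au.1, au.2) else None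
    else if x == Bit false then
      if q r is Some bt then Some (inr bt.1, bt.2) else None
    else None)); [exact: pt_id|exact: pt_const|].
apply: pt_if; first by apply: pt_eq_sym; pt_proj.
  apply: (pt_option (g := fun _ (au : A * seq sym) => Some (inl au.1, au.2))).
  - by apply: pt_comp ptp _; pt_proj.
  - exact: pt_const.
  - apply/pt_some/pt_pair; last by pt_proj.
    apply: (pt_code (f := fun x : seq sym * (sym * seq sym) * (A * seq sym) =>
      (Some x.2.1, None : option B))) => //.
    by apply: pt_pair; [apply: pt_some|]; pt_proj.
apply: pt_if; [by apply: pt_eq_sym; pt_proj| |exact: pt_const].
apply: (pt_option (g := fun _ (bt : B * seq sym) => Some (inr bt.1, bt.2))).
- by apply: pt_comp ptq _; pt_proj.
- exact: pt_const.
- apply/pt_some/pt_pair; last by pt_proj.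
  apply: (pt_code (f := fun x : seq sym * (sym * seq sym) * (B * seq sym) =>
    (None : option A, Some x.2.1))) => //.
  by apply: pt_pair; [|apply: pt_some]; pt_proj.
Qed.

(* The state is a flag telling whether the closing symbol has been read, the
   rest of the input and the items read so far in reverse order. *)
Definition item_step (st : option (bool * (seq sym * seq A))) :=
  if st is Some t then
    if t.1 then st else
    if t.2.1 is x :: r then
      if x == Close then Some (true, (r, t.2.2)) else
      if p t.2.1 is Some ar then Some (false, (ar.2, ar.1 :: t.2.2)) else None
    else None
  else None.

(** The remaining input itself is the loop counter. Each item uses up at least one symbol and
    [Close] another one, so there are enough rounds. *)
Definition parse_seq : parser (seq A) := fun s =>
  if s is x :: r then
    if x == Open then
      if foldl (fun st _ => item_step st) (Some (false, (r, [::]))) r is Some t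
      then if t.1 then Some (rev t.2.2, t.2.1) else None
      else None
    else None
  else None.

(** Makes one symbol decide whether the list ends, and makes every item use up input. *)
Hypothesis starts : forall a, exists x s, encA a = x :: s /\ x != Close.

Lemma iter_item_stop k t :
  iter k item_step (Some (true, t)) = Some (true, t) /\ iter k item_step None = None.
Proof. by elim: k => //= k [-> ->]. Qed.

Lemma iter_itemP k s acc r l :
  iter k item_step (Some (false, (s, acc))) = Some (true, (r, l)) ->
  exists2 t, s = flatten (map encA t) ++ Close :: r & l = catrev t acc.
Proof.
elim: k s acc => // k IH s acc; rewrite iterSr {2}/item_step /=.
case: s => [|x s]; first by rewrite (iter_item_stop k (r, l)).2.
case: eqP => [->|_].
  by rewrite (iter_item_stop k _).1 => -[-> ->]; exists [::].
case ep : (p _) => [[a t]|] /=; last by rewrite (iter_item_stop k (r, l)).2.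
by case/IH => u et ->; exists (a :: u) => //=; move/hp: ep => ->; rewrite et -catA.
Qed.

Lemma iter_item_flatten k t acc r : size t < k ->
  iter k item_step (Some (false, (flatten (map encA t) ++ Close :: r, acc))) =
  Some (true, (r, catrev t acc)).
Proof.
elim: k t acc => // k IH [|a t] acc lt_k; rewrite iterSr {2}/item_step /=.
  by rewrite (iter_item_stop k _).1.
rewrite -catA; set R := flatten _ ++ _.
have ep : p (encA a ++ R) = Some (a, R) by apply/hp.
have [x [u [e /negbTE ne]]] := starts a; move: ep; rewrite e /= ne => -> /=.
exact: (IH t).
Qed.

Lemma foldl_iter (T U : Type) (f : T -> T) z (s : seq U) :
  foldl (fun x _ => f x) z s = iter (size s) f z.
Proof. by elim: s z => //= _ s IH z; rewrite IH -iterSr. Qed.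

Lemma size_flatten_enc (t : seq A) : size t <= size (flatten (map encA t)).
Proof.
elim: t => //= a t IH; rewrite size_cat; have [x [u [-> _]]] := starts a.
by rewrite /=; lia.
Qed.

Lemma parse_seqP : parses (enc_seq encA) parse_seq.
Proof.
move=> s l r; rewrite /parse_seq /enc_seq; split=> [|->].
  case: s => // x s; case: eqP => // ->; rewrite foldl_iter.
  case e : (iter _ _ _) => [[[] [r' l']]|] //= [<- <-].
  have [t -> ->] := iter_itemP e.
  by rewrite catrevE cats0 revK cat_rcons.
rewrite /= cat_rcons foldl_iter iter_item_flatten.
  by rewrite /= catrevE cats0 revK.
by rewrite size_cat /=; have := size_flatten_enc l; lia.
Qed.

Lemma pt_item_step : pt item_step.
Proof.
apply: (pt_option (g := fun st (t : bool * (seq sym * seq A)) =>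
  if t.1 then st else
    if t.2.1 is x :: r then
      if x == Close then Some (true, (r, t.2.2)) else
      if p t.2.1 is Some ar then Some (false, (ar.2, ar.1 :: t.2.2)) else None
    else None)); [exact: pt_id|exact: pt_const|].
apply: pt_if; [by pt_proj|by pt_proj|].
apply: (pt_list (g := fun (u : option (bool * (seq sym * seq A)) * (bool * (seq sym * seq A)))
     (x : sym) (r : seq sym) => 
   if x == Close then Some (true, (r, u.2.2.2)) else
      if p u.2.2.1 is Some ar then Some (false, (ar.2, ar.1 :: u.2.2.2)) else None)).
- by pt_proj.
- exact: pt_const.
apply: pt_if; first by apply: pt_eq_sym; pt_proj.
  by apply: pt_some; pt_proj.
apply: (pt_option (g := fun (u : option (bool * (seq sym * seq A)) *
    (bool * (seq sym * seq A)) * (sym * seq sym)) (ar : A * seq sym) =>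
    Some (false, (ar.2, ar.1 :: u.1.2.2.2)))).
- by apply: pt_comp ptp _; pt_proj.
- exact: pt_const.
- apply/pt_some/pt_pair; first exact: pt_const.
  by apply: pt_pair; first pt_proj; apply: pt_cons; pt_proj.
Qed.

(** A round may add as much as a polynomial in the rest of the input, which belongs to the state, so
    [pt_foldl_add] does not apply. Since this rest only shrinks, the size of [s] bounds every
    round. *)
Lemma esize_iter_item e (s : seq sym) k :
  (forall u, esize (p u) <= (esize u + 2) ^ e) ->
  let st := iter k item_step (Some (false, (s, [::]))) in
  if st is Some t then
    esize t.2.1 <= esize s /\ esize t.2.2 <= k * ((esize s + 2) ^ e).+1 + 1
  else true.
Proof.
move=> bp; elim: k => //= k; case: (iter _ _ _) => //= -[[] [u acc]] /= [le1 le2].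
  by split=> //; lia.
case: u le1 => // x u le1; case: eqP => _ /=.
  by split; [move: le1; rewrite esize_cons|]; lia.
case ep : (p _) => [[a t]|] //=; have := bp (x :: u); rewrite ep esize_some esize_pair.
move/hp: ep => ep; have := esize_cat (encA a) t; rewrite -ep => sz.
have := leq_pow e (leq_add le1 (leqnn 2)); have := esize_gt0 (encA a).
by rewrite esize_cons; split; lia.
Qed.

Lemma pt_parse_seq : pt (parse_seq : seq sym -> option (seq A * seq sym)).
Proof.
pose run_items r := foldl (fun st (_ : sym) => item_step st) (Some (false, (r, [::]))) r.
have pt_run : pt run_items.
  have [e bp] := pt_bound ptp.
  have [d bd] : pbound (fun n => n + (n * ((n + 2) ^ e + 1) + 1) + 10) by pbound.
  apply: (pt_foldl (h := fun (_ : seq sym) st (_ : sym) => item_step st)).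
  - by apply: pt_comp pt_item_step _; pt_proj.
  - by apply/pt_some; pt_proj.
  - exact: pt_id.
  exists d => r k; rewrite foldl_iter; set k' := size _.
  have le_k : k' <= esize r.
    apply: leq_trans (ltnW (size_esize r)); rewrite /k' size_take; case: ifP => //; lia.
  have := esize_iter_item r k' bp; rewrite /=; case: (iter _ _ _) => [[b [u acc]]|] /=.
    move=> [le1 le2]; rewrite esize_some !esize_pair; apply: leq_trans (bd _).
    by have := esize_bool b; nia.
  by move=> _; apply: leq_trans (bd _); rewrite (_ : esize None = 1) //; lia.
apply: (pt_list (g := fun _ (x : sym) (r : seq sym) => if x == Open then
      if run_items r is Some t
      then if t.1 then Some (rev t.2.2, t.2.1) else None
      else None
    else None)); [exact: pt_id|exact: pt_const|].
apply: pt_if; [by apply: pt_eq_sym; pt_proj| |exact: pt_const].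
apply: (pt_option (g := fun _ (t : bool * (seq sym * seq A)) =>
   if t.1 then Some (rev t.2.2, t.2.1) else None)).
- by apply: pt_comp pt_run _; pt_proj.
- exact: pt_const.
- apply: pt_if; [by pt_proj| |exact: pt_const].
  by apply/pt_some/pt_pair; [apply: pt_rev|]; pt_proj.
Qed.

End Combinators.

Definition enc_bool (b : bool) : seq sym := [:: Bit b].

Definition parse_bool : parser bool := fun s =>
  if s is x :: r then
    if x == Bit true then Some (true, r) else
    if x == Bit false then Some (false, r) else None
  else None.

Lemma parse_boolP : parses enc_bool parse_bool.
Proof.
move=> [|x s] b r; split=> //=; case: eqP => [->|ne1].
- by move=> [<- <-].
- by case: eqP => // -> [<- <-].
- by move=> [<- <-].
- by move=> [e <-]; case: b e => e //; rewrite e eqxx.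
Qed.

Lemma pt_parse_bool : pt parse_bool.
Proof.
apply: (pt_list (g := fun (_ : seq sym) (x : sym) (r : seq sym) =>
    if x == Bit true then Some (true, r) else
    if x == Bit false then Some (false, r) else None)); [exact: pt_id|exact: pt_const|].
do 2?[apply: pt_if; first by apply: pt_eq_sym; pt_proj].
- by apply: pt_some; pt_proj.
- by apply: pt_some; pt_proj.
- exact: pt_const.
Qed.

Definition enc_unit (_ : unit) : seq sym := [::].

Definition parse_unit : parser unit := fun s => Some (tt, s).

Lemma parse_unitP : parses enc_unit parse_unit.
Proof. by move=> s [] r; split=> [[]|->]. Qed.

Lemma pt_parse_unit : pt parse_unit.
Proof. by apply: pt_some; pt_proj. Qed.


(** * The games *)

Definition bad (g : control) (sigma : order) (d c : candidate) : bool :=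
  match g with
  | Constructive => ~~ weakly_prefers sigma c d
  | Destructive => weakly_prefers sigma d c
  end.

Definition margin (g : control) : nat :=
  match g with Constructive => 0 | Destructive => 1 end.

(* Some good candidate is ahead of every bad one by the margin, and remains so
   if the bad one gets [e] further votes of which [k] can be removed. *)
Definition safe_dv (g : control) (C : seq candidate) (sigma : order)
    (d : candidate) (V : seq vote) (e k : nat) : bool :=
  all (fun b => bad g sigma d b ==> has (fun c => ~~ bad g sigma d c &&
    ((score V b + margin g <= score V c) &&
     (score V b + margin g + e - score V c <= k))) C) C.

Definition safe_av (g : control) (C : seq candidate) (sigma : order)
    (d : candidate) (V : seq vote) (m : nat) : bool :=
  all (fun b => bad g sigma d b ==> has (fun c => ~~ bad g sigma d c &&
    (score V b + margin g + m <= score V c)) C) C.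

Section Games.
Variables (g : control) (C : seq candidate) (sigma : order) (d : candidate).
Hypotheses (uniqC : uniq C) (d_C : d \in C).
Local Notation bad := (bad g sigma d).
Local Notation margin := (margin g).
Local Notation goal := (chair_goal g C sigma d).

(** The first inequality is separate because deletions can only undo votes still to come: spare ones
    do not make up for votes already kept. The deletions made so far will be counted in [e], so that
    [k] stays the original limit. *)
Lemma safe_dvP V e k : reflect
  (forall b, b \in C -> bad b -> exists2 c, c \in C & [/\ ~~ bad c,
     score V b + margin <= score V c & score V b + margin + e <= score V c + k])
  (safe_dv g C sigma d V e k).
Proof.
apply: (iffP allP) => h b b_C.
  move=> bb; have /implyP/(_ bb)/hasP[c c_C /and3P[nb le1 le2]] := h b b_C.
  by exists c; rewrite -?leq_subLR.
apply/implyP => /(h b b_C)[c c_C [nb le1 le2]]; apply/hasP; exists c => //.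
by rewrite nb le1 leq_subLR.
Qed.

Lemma safe_avP V m : reflect
  (forall b, b \in C -> bad b -> exists2 c, c \in C &
     ~~ bad c /\ score V b + margin + m <= score V c)
  (safe_av g C sigma d V m).
Proof.
apply: (iffP allP) => h b b_C.
  move=> bb; have /implyP/(_ bb)/hasP[c c_C /andP[nb le1]] := h b b_C.
  by exists c.
apply/implyP => /(h b b_C)[c c_C [nb le1]]; apply/hasP; exists c => //.
by rewrite nb le1.
Qed.

Lemma winner_exists V : exists2 c, c \in winners C V &
  forall c', c' \in C -> score V c' <= score V c.
Proof.
have [c c_C le_c] : exists2 c, c \in C & forall c', c' \in C -> score V c' <= score V c.
  (* The distinguished candidate only witnesses that [C] is nonempty and is generalized for the
     induction. *)
  elim: C (d) d_C => // c0 [|c1 C'] IH d' _.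
    by exists c0; rewrite ?mem_head // => c'; rewrite inE => /eqP->.
  have [c c_C le_c] := IH c1 (mem_head _ _).
  case: (leqP (score V c0) (score V c)) => le_c0.
    exists c; first by rewrite inE c_C orbT.
    by move=> c'; rewrite inE => /orP[/eqP->|/le_c].
  exists c0; first exact: mem_head.
  move=> c'; rewrite inE => /orP[/eqP->//|/le_c le'].
  exact: leq_trans le' (ltnW le_c0).
by exists c => //; rewrite mem_filter c_C andbT; apply/allP.
Qed.

Lemma winnersP V c : reflect (c \in C /\ forall c', c' \in C -> score V c' <= score V c)
  (c \in winners C V).
Proof.
rewrite mem_filter; apply: (iffP andP) => [[/allP h c_C]|[c_C h]]; split=> //.
exact/allP.
Qed.

(** Let [w] be a winner. In the constructive case, if [w] is bad, a good candidate with at least her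
    score wins as well. In the destructive case all winners must be good, so [w] is strictly ahead
    of every bad candidate. *)
Lemma chair_goalP V : goal V <-> safe_av g C sigma d V 0.
Proof.
have [w w_W le_w] := winner_exists V; have [w_C _] := winnersP _ _ w_W.
rewrite /safe_av; split.
  move=> hg; apply/safe_avP => b b_C; move: hg; rewrite /bad /margin; case: (g) => /=.
    move=> [c /winnersP[c_C le_c] pc] _; exists c => //.
    by rewrite negbK !addn0; split=> //; apply: le_c.
  move=> hg bb; exists w => //; rewrite addn0 addn1.
  split; first by apply/negP => bw; apply: hg; exists w.
  rewrite ltn_neqAle le_w // andbT; apply/negP => /eqP e; apply: hg; exists b => //.
  by apply/winnersP; split=> // c' /le_w; rewrite e.
move/safe_avP; rewrite /bad /margin; case: (g) => /= h.
  case: (boolP (weakly_prefers sigma w d)) => pw; first by exists w.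
  have [c c_C [pc le_c]] := h w w_C pw; exists c; last by rewrite negbK in pc.
  by apply/winnersP; split=> // c' /le_w; move: le_c; rewrite !addn0; lia.
move=> [b /winnersP[b_C le_b] pb]; have [c c_C [_]] := h b b_C pb.
by have := le_b c c_C; lia.
Qed.

Lemma score_rcons V v c : score (rcons V v) c = score V c + (ohead v.2 == Some c).
Proof. by rewrite /score -cats1 count_cat /= addn0. Qed.

Lemma order_for b : b \in C -> is_order C (b :: rem b C).
Proof. by move=> b_C; rewrite /is_order perm_sym perm_to_rem. Qed.

Lemma order_head p : is_order C p -> exists2 t, t \in C & ohead p = Some t.
Proof.
move=> pC; have : d \in p by rewrite (perm_mem pC).
by case: p pC => // t p pC _; exists t => //; rewrite -(perm_mem pC) mem_head.
Qed.

Lemma score_self x V b s : score (rcons V (x, b :: s)) b = (score V b).+1.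
Proof. by rewrite score_rcons /= eqxx addn1. Qed.

Lemma score_other x V b s c : ~~ bad c -> bad b ->
  score (rcons V (x, b :: s)) c = score V c.
Proof.
move=> nc bb; rewrite score_rcons /= (_ : (_ == _) = false) ?addn0 //.
by apply/eqP => -[e]; rewrite -e bb in nc.
Qed.

(** * Closed forms of the two games *)

Lemma safe_dv_step x V n m k : n <= k ->
  (forall p, is_order C p ->
     safe_dv g C sigma d (rcons V (x, p)) (m + n) k \/
     n < k /\ safe_dv g C sigma d V (m + n.+1) k) <->
  safe_dv g C sigma d V (m.+1 + n) k.
Proof.
move=> le_nk; split=> [h|/safe_dvP h p /order_head[t t_C pt]].
  (* Test against a vote for [b]: keeping it raises the score of [b], deleting it raises the number
     of deletions, and the budget inequality is the same in both cases. *)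
  apply/safe_dvP => b b_C bb; have [/safe_dvP|[_ /safe_dvP]] := h _ (order_for b_C).
    move=> /(_ b b_C bb)[c c_C [nc]]; rewrite score_self score_other // => le1 le2.
    by exists c => //; split=> //; lia.
  by move=> /(_ b b_C bb)[c c_C [nc le1 le2]]; exists c => //; split=> //; lia.
have sc c : score (rcons V (x, p)) c = score V c + (t == c).
  by rewrite score_rcons /= pt.
have mono c : score V c <= score (rcons V (x, p)) c by rewrite sc leq_addr.
(* The chair's strategy: keep a vote for a good candidate; keep a vote for a bad [t] if some good
   candidate has slack against [t]; otherwise delete it. *)
case: (boolP (bad t)) => bt; last first.
  left; apply/safe_dvP => b b_C bb; have [c c_C [nc le1 le2]] := h b b_C bb.
  exists c => //; rewrite (sc b).
  have -> : (t == b) = false by apply/eqP => e; rewrite e bb in bt.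
  by split=> //; clear -le1 le2 mono; have := mono c; lia.
have [c c_C [nc le1 le2]] := h t t_C bt.
have scg c' : ~~ bad c' -> score (rcons V (x, p)) c' = score V c'.
  by move=> nc'; rewrite sc; case: eqP => [e|_]; [rewrite -e bt in nc'|rewrite addn0].
case: (boolP (has (fun c' => ~~ bad c' && (score V t + margin < score V c')) C)).
  move=> /hasP[c' c'_C /andP[nc' lt']]; left; apply/safe_dvP => b b_C bb.
  case: (eqVneq t b) => [e|ne].
    (* [c'] has the slack and [c] satisfies the budget inequality; the one with the higher score has
       both. *)
    case: (leqP (score V c) (score V c')) => le_c.
      by exists c' => //; rewrite (scg c') // sc -e eqxx; split=> //; clear -le1 le2 lt' le_c; lia.
    by exists c => //; rewrite (scg c) // sc -e eqxx; split=> //; clear -le1 le2 lt' le_c; lia.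
  have [c1 c1_C [nc1 le11 le12]] := h b b_C bb; exists c1 => //.
  by rewrite (scg c1) // sc (negbTE ne); split=> //; clear -le11 le12; lia.
(* Without slack the score of [c] is at most that of [t] plus the margin, so the budget inequality
   for [t] yields [m.+1 + n <= k]: a deletion is left. *)
move=> /hasPn /(_ c c_C); rewrite nc /= -leqNgt => le3; right; split; first by lia.
apply/safe_dvP => b b_C bb; have [c1 c1_C [nc1 le11 le12]] := h b b_C bb.
by exists c1 => //; split=> //; clear -le12; lia.
Qed.

(** The local function of [dv_force] given a name: the closed form describes the moments between two
    voters, before the next vote is revealed. *)
Definition dv_continue (k n : nat) (V : seq vote) (future : seq voter) : Prop :=
  if future is x :: future' then
    forall p, is_order C p -> dv_force C k goal n V (x, p) future'
  else goal V.

Lemma dv_forceE k n V v future : dv_force C k goal n V v future <->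
  dv_continue k n (rcons V v) future \/ n < k /\ dv_continue k n.+1 V future.
Proof. by case: future. Qed.

Lemma dv_continueP k n V future : n <= k ->
  dv_continue k n V future <-> safe_dv g C sigma d V (size future + n) k.
Proof.
elim: future n V => [|x future IH] n V le_nk.
  (* With no voter to come, the budget inequality follows from the first one and [n <= k]. *)
  rewrite /dv_continue chair_goalP; split=> [/safe_avP h|/safe_dvP h].
    apply/safe_dvP => b b_C bb; have [c c_C [nc le1]] := h b b_C bb.
    by exists c => //; split=> //; clear -le1 le_nk; rewrite /= ?add0n; lia.
  apply/safe_avP => b b_C bb; have [c c_C [nc le1 le2]] := h b b_C bb.
  by exists c => //; split=> //; clear -le1; lia.
rewrite -(safe_dv_step x) //=; split=> h p /h; rewrite dv_forceE IH //.
  by case=> [?|[lt_nk]]; [left|right; rewrite -IH].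
by case=> [?|[lt_nk ?]]; [left|right; rewrite IH].
Qed.

Lemma safe_av_step_reg x V m :
  (forall p, is_order C p -> safe_av g C sigma d (rcons V (x, p)) m) <->
  safe_av g C sigma d V m.+1.
Proof.
split=> [h|/safe_avP h p /order_head[t t_C pt]].
  apply/safe_avP => b b_C bb; have /safe_avP/(_ b b_C bb)[c c_C [nc]] := h _ (order_for b_C).
  by rewrite score_self score_other // => le1; exists c => //; split=> //; lia.
apply/safe_avP => b b_C bb; have [c c_C [nc le1]] := h b b_C bb.
exists c => //; split=> //; rewrite !score_rcons /=.
by move: (leq_b1 (ohead p == Some b)) le1; clear; lia.
Qed.

(** An unregistered voter cannot be relied on: when she votes for [b], adding her does not improve
    any good candidate's lead over [b]. The chair may leave her out, so she does no harm. [P] stands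
    for the availability of an addition. *)
Lemma safe_av_step_unreg x V m (P : Prop) :
  (forall p, is_order C p -> safe_av g C sigma d V m \/
     P /\ safe_av g C sigma d (rcons V (x, p)) m) <->
  safe_av g C sigma d V m.
Proof.
split=> [h|h p _]; last by left.
apply/safe_avP => b b_C bb; have [/safe_avP|[_ /safe_avP]] := h _ (order_for b_C).
  exact.
move=> /(_ b b_C bb)[c c_C [nc]]; rewrite score_self score_other // => le1.
by exists c => //; split=> //; lia.
Qed.

Definition av_continue (k n : nat) (V : seq vote) (future : seq (voter * bool)) : Prop :=
  if future is x :: future' then
    forall p, is_order C p -> av_force C k goal n V (x.1, p) x.2 future'
  else goal V.

Lemma av_forceE k n V v reg future : av_force C k goal n V v reg future <->
  if reg then av_continue k n (rcons V v) future else
  av_continue k n V future \/ n < k /\ av_continue k n.+1 (rcons V v) future.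
Proof. by case: future; case: reg. Qed.

Lemma av_continueP k n V future :
  av_continue k n V future <-> safe_av g C sigma d V (count snd future).
Proof.
elim: future n V => [|[x []] future IH] n V; first exact: chair_goalP.
  rewrite -(safe_av_step_reg x) /=; split=> h p /h; rewrite av_forceE ?IH //.
rewrite -(safe_av_step_unreg x _ _ (n < k)) /=.
by split=> h p /h; rewrite av_forceE !IH.
Qed.

End Games.


(** * The decision procedures *)

Ltac pt_ctx := solve [repeat first
  [ match goal with
    | H : pt ?f |- pt ?f => exact: H
    | H : ptn ?f |- ptn ?f => exact: H
    end
  | apply: pt_id | apply: pt_const | apply: pt_fst | apply: pt_snd | apply: pt_pair
  | match goal with
    | H : pt ?f |- pt _ => apply: (pt_comp (g := f) H)
    | H : ptn ?f |- ptn _ => apply: (ptn_comp (g := f) H)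
    end]].

Section Elections.
Variable X : encType.

Lemma pt_perm_eq (s t : X -> seq nat) :
  pt s -> pt t -> pt (fun x => perm_eq (s x) (t x)).
Proof.
move=> hs ht; apply: (pt_all (g := fun x (y : nat) =>
  count_mem y (s x) == count_mem y (t x))); last exact: pt_cat.
apply: pt_eqn.
  by apply: (ptn_count (g := fun (p : X * nat) (y : nat) => y == p.2)); [apply: pt_eq|]; pt_ctx.
by apply: (ptn_count (g := fun (p : X * nat) (y : nat) => y == p.2)); [apply: pt_eq|]; pt_ctx.
Qed.

Lemma pt_uniq (s : X -> seq nat) : pt s -> pt (fun x => uniq (s x)).
Proof.
move=> hs; apply: (@pt_ext _ _ (fun x => all (fun y => count_mem y (s x) <= 1) (s x))).
  move=> x; apply/allP/idP => [h|u y _]; last by rewrite count_uniq_mem // leq_b1.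
  apply: count_mem_uniq => y; case: (boolP (y \in s x)) => hy; last exact/count_memPn.
  by apply/eqP; rewrite eqn_leq h //= -has_count has_pred1.
apply: (pt_all (g := fun x (y : nat) => count_mem y (s x) <= 1)) => //.
apply: pt_leq; last exact: ptn_const.
by apply: (ptn_count (g := fun (p : X * nat) (y : nat) => y == p.2)); [apply: pt_eq|]; pt_ctx.
Qed.

Lemma pt_weakly_prefers (p : X -> seq nat) (c d : X -> nat) :
  pt p -> pt c -> pt d -> pt (fun x => weakly_prefers (p x) (c x) (d x)).
Proof.
move=> hp hc hd; apply: pt_orb; first exact: pt_eq.
have hi (a : X -> nat) : pt a -> ptn (fun x => index (a x) (p x)).
  move=> ha; apply: (ptn_find (g := fun x (y : nat) => y == a x)) => //.
  by apply: pt_eq; pt_ctx.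
apply: (pt_leq (f := fun x => (index (c x) (p x)).+1)); last exact: hi.
exact/ptn_succ/hi.
Qed.

Lemma ptn_score (V : X -> seq (nat * seq nat)) (c : X -> nat) :
  pt V -> pt c -> ptn (fun x => score (V x) (c x)).
Proof.
move=> hV hc; apply: (ptn_count (g := fun x (v : nat * seq nat) => ohead v.2 == Some (c x))) => //.
apply: (@pt_ext _ _ (fun q : X * (nat * seq nat) =>
  if q.2.2 is a :: _ then a == c q.1 else false)).
  by move=> [x [i [|a s]]].
by apply: (pt_list (g := fun q (a : nat) (_ : seq nat) => a == c q.1));
  [| |apply: pt_eq]; pt_ctx.
Qed.

End Elections.

Lemma pt_all_orders (X : encType) (C : X -> seq nat) (V : X -> seq (nat * seq nat)) :
  pt C -> pt V -> pt (fun x => all (fun v : vote => is_order (C x) v.2) (V x)).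
Proof.
move=> hC hV; apply: (pt_all (g := fun x (v : nat * seq nat) => is_order (C x) v.2)) => //.
by apply: pt_perm_eq; pt_ctx.
Qed.

Lemma pt_bad g (X : encType) (sigma : X -> seq nat) (d c : X -> nat) :
  pt sigma -> pt d -> pt c -> pt (fun x => bad g (sigma x) (d x) (c x)).
Proof.
move=> hs hd hc; case: g; last exact: pt_weakly_prefers.
exact/pt_negb/pt_weakly_prefers.
Qed.

(** The subtraction in [safe_dv] leaves the binary [k] alone on the right-hand side, as [pt_leq_nat]
    requires; all other numbers are unary. *)
Lemma pt_safe_dv g (X : encType) (C sigma : X -> seq nat) (d : X -> nat)
  (V : X -> seq (nat * seq nat)) (e k : X -> nat) :
  pt C -> pt sigma -> pt d -> pt V -> ptn e -> pt k ->
  pt (fun x => safe_dv g (C x) (sigma x) (d x) (V x) (e x) (k x)).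
Proof.
move=> hC hs hd hV he hk.
apply: (pt_all (g := fun x (b : nat) => bad g (sigma x) (d x) b ==>
  has (fun c => ~~ bad g (sigma x) (d x) c &&
    ((score (V x) b + margin g <= score (V x) c) &&
     (score (V x) b + margin g + e x - score (V x) c <= k x))) (C x))) => //.
apply: pt_implyb; first by apply: pt_bad; pt_ctx.
apply: (pt_has (g := fun (q : X * nat) (c : nat) => ~~ bad g (sigma q.1) (d q.1) c &&
    ((score (V q.1) q.2 + margin g <= score (V q.1) c) &&
     (score (V q.1) q.2 + margin g + e q.1 - score (V q.1) c <= k q.1)))); last by pt_ctx.
apply: pt_andb; first by apply: pt_negb; apply: pt_bad; pt_ctx.
have hb : ptn (fun q : X * nat * nat => score (V q.1.1) q.1.2 + margin g).
  by apply: ptn_add; [apply: ptn_score; pt_ctx|apply: ptn_const].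
have hc : ptn (fun q : X * nat * nat => score (V q.1.1) q.2).
  by apply: ptn_score; pt_ctx.
apply: pt_andb; first exact: pt_leq.
apply: pt_leq_nat; last by pt_ctx.
by apply: ptn_sub => //; apply: ptn_add => //; pt_ctx.
Qed.

Lemma pt_safe_av g (X : encType) (C sigma : X -> seq nat) (d : X -> nat)
  (V : X -> seq (nat * seq nat)) (m : X -> nat) :
  pt C -> pt sigma -> pt d -> pt V -> ptn m ->
  pt (fun x => safe_av g (C x) (sigma x) (d x) (V x) (m x)).
Proof.
move=> hC hs hd hV hm.
apply: (pt_all (g := fun x (b : nat) => bad g (sigma x) (d x) b ==>
  has (fun c => ~~ bad g (sigma x) (d x) c &&
    (score (V x) b + margin g + m x <= score (V x) c)) (C x))) => //.
apply: pt_implyb; first by apply: pt_bad; pt_ctx.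
apply: (pt_has (g := fun (q : X * nat) (c : nat) => ~~ bad g (sigma q.1) (d q.1) c &&
    (score (V q.1) q.2 + margin g + m q.1 <= score (V q.1) c))); last by pt_ctx.
apply: pt_andb; first by apply: pt_negb; apply: pt_bad; pt_ctx.
apply: pt_leq; last by apply: ptn_score; pt_ctx.
apply: ptn_add; last by pt_ctx.
by apply: ptn_add; [apply: ptn_score; pt_ctx|apply: ptn_const].
Qed.

(** * Encodings with polynomial-time parsers *)

Definition parsable (A : encType) (enc : A -> seq sym) : Prop :=
  exists2 p : seq sym -> option (A * seq sym), pt p & parses enc p.

Lemma parsable_nat : parsable enc_nat.
Proof. by exists parse_nat; [exact: pt_parse_nat|exact: parse_natP]. Qed.

Lemma parsable_bool : parsable enc_bool.
Proof. by exists parse_bool; [exact: pt_parse_bool|exact: parse_boolP]. Qed.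

Lemma parsable_unit : parsable enc_unit.
Proof. by exists parse_unit; [exact: pt_parse_unit|exact: parse_unitP]. Qed.

Lemma parsable_pair (A B : encType) (encA : A -> seq sym) (encB : B -> seq sym) :
  parsable encA -> parsable encB -> parsable (enc_pair encA encB).
Proof.
move=> [p ptp hp] [q ptq hq]; exists (parse_pair p q); first exact: pt_parse_pair.
exact: parse_pairP.
Qed.

Lemma parsable_sum (A B : encType) (encA : A -> seq sym) (encB : B -> seq sym) :
  parsable encA -> parsable encB -> parsable (enc_sum encA encB).
Proof.
move=> [p ptp hp] [q ptq hq]; exists (parse_sum p q); first exact: pt_parse_sum.
exact: parse_sumP.
Qed.

Definition starts (A : Type) (enc : A -> seq sym) : Prop :=
  forall a, exists x s, enc a = x :: s /\ x != Close.

Lemma parsable_seq (A : encType) (enc : A -> seq sym) :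
  starts enc -> parsable enc -> parsable (enc_seq enc).
Proof.
move=> st [p ptp hp]; exists (parse_seq p); first exact: pt_parse_seq hp.
exact: parse_seqP.
Qed.

Lemma starts_nat : starts enc_nat.
Proof.
move=> n; rewrite /enc_nat; case: (nat_bits n) => [|b s]; first by exists Sep, [::].
by exists (Bit b), (rcons (map Bit s) Sep).
Qed.

Lemma starts_pair (A B : encType) (encA : A -> seq sym) (encB : B -> seq sym) :
  starts encA -> starts (enc_pair encA encB).
Proof.
move=> st [a b]; have [x [s [e ne]]] := st a.
by exists x, (s ++ encB b); rewrite /enc_pair e.
Qed.

Lemma parsable_order : parsable enc_order.
Proof. exact: parsable_seq starts_nat parsable_nat. Qed.

Lemma enc_seq_map (A B : Type) (f : A -> B) (enc : B -> seq sym) s :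
  enc_seq enc (map f s) = enc_seq (fun a => enc (f a)) s.
Proof. by rewrite /enc_seq -map_comp. Qed.

Lemma eq_enc_seq (A : Type) (enc enc' : A -> seq sym) :
  enc =1 enc' -> enc_seq enc =1 enc_seq enc'.
Proof. by move=> e s; rewrite /enc_seq (eq_map e). Qed.

Lemma parsable_in_P (A : encType) (enc : A -> seq sym) (f : A -> bool) (L : language sym) :
  parsable enc -> pt f -> (forall w, L w <-> exists2 a, w = enc a & f a) -> in_P L.
Proof.
move=> [p ptp hp] hf hL.
apply: (@pt_in_P (fun w => if p w is Some ar then nilp ar.2 && f ar.1 else false)).
  apply: (pt_option (g := fun _ (ar : A * seq sym) => nilp ar.2 && f ar.1)) => //.
    exact: pt_const.
  by apply: pt_andb; [apply: pt_nilp|]; pt_ctx.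
move=> w; rewrite hL; split=> [|[a ->] fa].
  case e : (p w) => [[a r]|] //= /andP[/nilP r0 fa]; exists a => //.
  by move/hp: e => ->; rewrite r0 cats0.
by have /hp-> : enc a = enc a ++ [::] by rewrite cats0.
Qed.

(** ** Deleting voters *)

(** Nested pairs in the order of the encoding. Deleted voters are on the left of the sum, so that
    the tags of [enc_sum] agree with those of [enc_dv_past]. *)
Notation dv_data := (seq nat * (seq (nat * (unit + seq nat)) * (nat * seq nat *
  (seq nat * (seq nat * (nat * nat))))))%type.

Definition dv_of (t : dv_data) : dv_instance :=
  DVInstance t.1 [seq (e.1, getr e.2) | e <- t.2.1] t.2.2.1 t.2.2.2.1
    t.2.2.2.2.1 t.2.2.2.2.2.1 t.2.2.2.2.2.2.

Definition enc_dv_data : dv_data -> seq sym :=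
  enc_pair enc_order (enc_pair (enc_seq (enc_pair enc_nat (enc_sum enc_unit enc_order)))
    (enc_pair enc_vote (enc_pair enc_order (enc_pair enc_order
    (enc_pair enc_nat enc_nat))))).

Lemma enc_dv_dataE t : enc_dv_data t = enc_dv (dv_of t).
Proof.
rewrite /enc_dv (_ : enc_seq enc_dv_past _ =
  enc_seq (enc_pair enc_nat (enc_sum enc_unit enc_order)) t.2.1) //.
by rewrite enc_seq_map; apply: eq_enc_seq => -[i [[]|p]].
Qed.

Lemma dv_of_surj I : exists t, dv_of t = I.
Proof.
case: I => C past u fut sigma d k.
exists (C, ([seq (e.1, if e.2 is Some p then inr p else inl tt) | e <- past],
  (u, (fut, (sigma, (d, k)))))).
rewrite /dv_of /= -map_comp; congr DVInstance.
by rewrite -[RHS]map_id; apply: eq_map => -[i [p|]].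
Qed.

Definition dv_decide (g : control) (I : dv_instance) : bool :=
  let C := dv_candidates I in let safe := safe_dv g C (dv_chair I) (dv_dist I) in
  dv_wf I &&
  (safe (rcons (dv_kept I) (dv_current I)) (size (dv_future I) + dv_deleted I) (dv_limit I) ||
   ((dv_deleted I).+1 <= dv_limit I) &&
   safe (dv_kept I) (size (dv_future I) + (dv_deleted I).+1) (dv_limit I)).

Lemma dv_decideP g I : dv_decide g I <-> dv_wf I /\ dv_yes g I.
Proof.
rewrite /dv_decide /dv_yes; case wf : (dv_wf I); last by split=> [//|[]].
have /and5P[uC dC oC _ /andP[_ le_k]] := wf.
rewrite dv_forceE dv_continueP //=; split=> [h|[_ h]].
  split=> //; case/orP: h => [->|/andP[lt_k h]]; first by left.
  by right; rewrite dv_continueP.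
apply/orP; case: h => [->|[lt_k]]; first by left.
by rewrite dv_continueP // => h; right; rewrite lt_k.
Qed.

Lemma pt_dv_decide g : pt (fun t : dv_data => dv_decide g (dv_of t)).
Proof.
have hp : pt (fun t : dv_data => [seq (e.1, getr e.2) | e <- t.2.1]).
  apply: (pt_map (g := fun _ (e : nat * (unit + seq nat)) => (e.1, getr e.2))).
    by apply: pt_pair; [|apply: pt_getr]; pt_ctx.
  by pt_ctx.
have hV : pt (fun t : dv_data => dv_kept (dv_of t) : seq (nat * seq nat)).
  apply: (pt_pmap (g := fun _ (e : nat * option (seq nat)) => omap (pair e.1) e.2)) => //.
  by apply: pt_omap_pair; pt_ctx.
have hn : ptn (fun t : dv_data => dv_deleted (dv_of t)).
  apply: (ptn_count (g := fun _ (e : nat * option (seq nat)) => ~~ e.2)) => //.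
  by apply/pt_negb/pt_isSome; pt_ctx.
have hC : pt (fun t : dv_data => dv_candidates (dv_of t)) by rewrite /=; pt_ctx.
have hs : pt (fun t : dv_data => dv_chair (dv_of t)) by rewrite /=; pt_ctx.
have hd : pt (fun t : dv_data => dv_dist (dv_of t)) by rewrite /=; pt_ctx.
have hk : pt (fun t : dv_data => dv_limit (dv_of t)) by rewrite /=; pt_ctx.
have hu : pt (fun t : dv_data => dv_current (dv_of t)) by rewrite /=; pt_ctx.
have hf : ptn (fun t : dv_data => size (dv_future (dv_of t))).
  by apply: ptn_size; rewrite /=; pt_ctx.
apply: pt_andb; last apply: pt_orb; last apply: pt_andb.
- do ![apply: pt_andb].
  + exact: pt_uniq.
  + exact: pt_mem.
  + exact: pt_perm_eq.
  + exact: pt_all_orders.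
  + by apply: pt_perm_eq => //; apply: pt_snd.
  + exact: pt_leq_nat.
- by apply: pt_safe_dv => //; [exact: pt_rcons|apply: ptn_add].
- by apply: pt_leq_nat => //; apply: ptn_succ.
- by apply: pt_safe_dv => //; apply: ptn_add => //; apply: ptn_succ.
Qed.

Lemma parsable_dv : parsable enc_dv_data.
Proof.
have pv : parsable enc_vote := parsable_pair parsable_nat parsable_order.
do !first [exact: pv|exact: parsable_nat|exact: parsable_order|exact: parsable_unit
  |apply: parsable_pair|apply: parsable_sum|apply: parsable_seq].
exact: starts_pair starts_nat.
Qed.

Lemma in_P_DV g : in_P (online_plurality_DV g).
Proof.
apply: parsable_in_P parsable_dv (pt_dv_decide g) _ => w; split.
  move=> [I [-> wf yes]]; have [t et] := dv_of_surj I; exists t.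
    by rewrite enc_dv_dataE et.
  by rewrite et; apply/dv_decideP.
move=> [t -> /dv_decideP[wf yes]]; exists (dv_of t).
by rewrite enc_dv_dataE.
Qed.

(** ** Adding voters *)

(** The nested sum yields the tags of [enc_av_past]: one bit for a registered voter, two bits for
    the others. *)
Notation av_data := (seq nat * (seq (nat * (seq nat + (seq nat + unit))) *
  (nat * seq nat * (seq (nat * bool) * (seq nat * (nat * nat))))))%type.

Definition status_of (x : seq nat + (seq nat + unit)) : past_status :=
  match x with
  | inl p => Registered p
  | inr (inl p) => Added p
  | inr (inr _) => NotAdded
  end.

Definition av_of (t : av_data) : av_instance :=
  AVInstance t.1 [seq (e.1, status_of e.2) | e <- t.2.1] t.2.2.1 t.2.2.2.1
    t.2.2.2.2.1 t.2.2.2.2.2.1 t.2.2.2.2.2.2.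

Definition enc_av_data : av_data -> seq sym :=
  enc_pair enc_order (enc_pair
    (enc_seq (enc_pair enc_nat (enc_sum enc_order (enc_sum enc_order enc_unit))))
    (enc_pair enc_vote (enc_pair (enc_seq (enc_pair enc_nat enc_bool))
    (enc_pair enc_order (enc_pair enc_nat enc_nat))))).

Lemma enc_av_dataE t : enc_av_data t = enc_av (av_of t).
Proof.
rewrite /enc_av (_ : enc_seq enc_av_past _ =
  enc_seq (enc_pair enc_nat (enc_sum enc_order (enc_sum enc_order enc_unit))) t.2.1).
  rewrite (_ : enc_seq enc_av_future _ = enc_seq (enc_pair enc_nat enc_bool) t.2.2.2.1) //.
  by apply: eq_enc_seq => e; rewrite /enc_av_future -cats1.
by rewrite enc_seq_map; apply: eq_enc_seq => -[i [p|[p|[]]]].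
Qed.

Lemma av_of_surj I : exists t, av_of t = I.
Proof.
case: I => C past u fut sigma d k.
exists (C, ([seq (e.1, match e.2 with Registered p => inl p | Added p => inr (inl p)
  | NotAdded => inr (inr tt) end) | e <- past], (u, (fut, (sigma, (d, k)))))).
rewrite /av_of /= -map_comp; congr AVInstance.
by rewrite -[RHS]map_id; apply: eq_map => -[i [p|p|]].
Qed.

Definition av_decide (g : control) (I : av_instance) : bool :=
  let C := av_candidates I in let safe := safe_av g C (av_chair I) (av_dist I) in
  av_wf I &&
  (safe (av_counted I) (count snd (av_future I)) ||
   ((av_added I).+1 <= av_limit I) &&
   safe (rcons (av_counted I) (av_current I)) (count snd (av_future I))).

Lemma av_decideP g I : av_decide g I <-> av_wf I /\ av_yes g I.
Proof.
rewrite /av_decide /av_yes; case wf : (av_wf I); last by split=> [//|[]].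
have /and5P[uC dC oC _ /andP[_ le_k]] := wf.
rewrite av_forceE !av_continueP //=; split=> [h|[_ h]].
  by split=> //; case/orP: h => [->|/andP[lt_k h]]; [left|right].
by apply/orP; case: h => [->|[lt_k h]]; [left|right; rewrite lt_k].
Qed.

Lemma pt_av_decide g : pt (fun t : av_data => av_decide g (av_of t)).
Proof.
pose added (x : seq nat + (seq nat + unit)) := if getr x is Some y then getl y else None.
have ha : pt added.
  apply: (pt_option (g := fun _ (y : seq nat + unit) => getl y)).
  - by apply: pt_getr; pt_ctx.
  - exact: pt_const.
  - by apply: pt_getl; pt_ctx.
have ho : pt (fun x => status_order (status_of x)).
  apply: (@pt_ext _ _ (fun x => if getl x is Some p then Some p else added x)).
    by move=> [p|[p|[]]].
  apply: (pt_option (g := fun _ (p : seq nat) => Some p)) => //.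
  - by apply: pt_getl; pt_ctx.
  - by apply: pt_some; pt_ctx.
have hV : pt (fun t : av_data => av_counted (av_of t) : seq (nat * seq nat)).
  apply: (@pt_ext _ _ (fun t => pmap (fun e : nat * (seq nat + (seq nat + unit)) =>
     omap (pair e.1) (status_order (status_of e.2))) t.2.1)).
    by move=> t; rewrite /av_counted /=; elim: t.2.1 => //= e s ->.
  apply: (pt_pmap (g := fun _ (e : nat * (seq nat + (seq nat + unit))) =>
     omap (pair e.1) (status_order (status_of e.2)))); last by pt_ctx.
  by apply: pt_omap_pair; pt_ctx.
have hn : ptn (fun t : av_data => av_added (av_of t)).
  apply: (@ptn_ext _ (fun t => count (fun e : nat * (seq nat + (seq nat + unit)) =>
     isSome (added e.2)) t.2.1)).
    by move=> t; rewrite /av_added /= count_map; apply: eq_count => -[i [p|[p|[]]]].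
  apply: (ptn_count (g := fun _ (e : nat * (seq nat + (seq nat + unit))) =>
     isSome (added e.2))); last by pt_ctx.
  by apply: pt_isSome; pt_ctx.
have hC : pt (fun t : av_data => av_candidates (av_of t)) by rewrite /=; pt_ctx.
have hs : pt (fun t : av_data => av_chair (av_of t)) by rewrite /=; pt_ctx.
have hd : pt (fun t : av_data => av_dist (av_of t)) by rewrite /=; pt_ctx.
have hk : pt (fun t : av_data => av_limit (av_of t)) by rewrite /=; pt_ctx.
have hu : pt (fun t : av_data => av_current (av_of t)) by rewrite /=; pt_ctx.
have hf : ptn (fun t : av_data => count snd (av_future (av_of t))).
  apply: (ptn_count (g := fun _ (e : nat * bool) => e.2)); first by pt_ctx.
  by rewrite /=; pt_ctx.
apply: pt_andb; last apply: pt_orb; last apply: pt_andb.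
- do ![apply: pt_andb].
  + exact: pt_uniq.
  + exact: pt_mem.
  + exact: pt_perm_eq.
  + exact: pt_all_orders.
  + by apply: pt_perm_eq => //; apply: pt_snd.
  + exact: pt_leq_nat.
- exact: pt_safe_av.
- by apply: pt_leq_nat => //; apply: ptn_succ.
- by apply: pt_safe_av => //; apply: pt_rcons.
Qed.

Lemma parsable_av : parsable enc_av_data.
Proof.
have pv : parsable enc_vote := parsable_pair parsable_nat parsable_order.
do !first [exact: pv|exact: parsable_nat|exact: parsable_order|exact: parsable_unit
  |exact: parsable_bool|apply: parsable_pair|apply: parsable_sum|apply: parsable_seq];
exact: starts_pair starts_nat.
Qed.

Lemma in_P_AV g : in_P (online_plurality_AV g).
Proof.
apply: parsable_in_P parsable_av (pt_av_decide g) _ => w; split.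
  move=> [I [-> wf yes]]; have [t et] := av_of_surj I; exists t.
    by rewrite enc_av_dataE et.
  by rewrite et; apply/av_decideP.
move=> [t -> /av_decideP[wf yes]]; exists (av_of t).
by rewrite enc_av_dataE.
Qed.

Theorem theorem5p1 :
  [/\ in_P online_plurality_CCDV,
      in_P online_plurality_CCAV,
      in_P online_plurality_DCDV
    & in_P online_plurality_DCAV].
Proof. by split; [apply: in_P_DV|apply: in_P_AV|apply: in_P_DV|apply: in_P_AV]. Qed.
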